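(* Let $\theta$ be an irrational number, let $\tau=\tau_1+i\tau_2$ be a complex number with $\tau_2>0$, let $w\in\mathbb{C}$, and let $k\in A_\theta^\infty$ be a positive invertible element. Let $\Delta'_0$ and $\Delta'_1$ be the twisted Dolbeault Laplacians on $(0,0)$- and $(1,0)$-sections perturbed by the Weyl factor $k$; up to anti-unitary equivalence they are the operators on $\mathcal{H}_0$ $$\Delta'_0\sim k(-\overline{w}+\partial^* )(-w+\partial)k,\qquad \Delta'_1\sim(-\overline{w}+\partial^* )k^2(-w+\partial),$$ where $k$ and $k^2$ act by left multiplication. Let $B_2(\Delta'_i)$ denote the coefficient of $t^0$ in the small-time asymptotic expansion of $\mathrm{Tr}(e^{-t\Delta'_i})$. Then $$B_2(\Delta'_0)-B_2(\Delta'_1)=0.$$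
   Context: $A_\theta$ is the universal unital $C^*$-algebra generated by unitaries $U,V$ with $VU=e^{2\pi i\theta}UV$. $A_\theta^\infty$ is its dense $*$-subalgebra of smooth elements: the series $\sum_{m,n\in\mathbb{Z}}a_{m,n}U^mV^n$ with rapidly decreasing coefficients. The normalized trace is $\tau_0(\sum a_{m,n}U^mV^n)=a_{0,0}$, and $\mathcal{H}_0$ is the Hilbert space completion of $A_\theta$ for $\langle a,b\rangle=\tau_0(b^*a)$. The derivations $\delta_1,\delta_2$ of $A_\theta^\infty$ are given by $\delta_1(U)=U$, $\delta_1(V)=0$, $\delta_2(U)=0$, $\delta_2(V)=V$; they extend to selfadjoint unbounded operators on $\mathcal{H}_0$. Put $\partial=\delta_1+\overline{\tau}\delta_2$ and $\partial^*=\delta_1+\tau\delta_2$. Origin of the Laplacians. Write $k=e^{h/2}$ with $h=h^*\in A_\theta^\infty$, let $\varphi(a)=\tau_0(ae^{-h})$, and let $\mathcal{H}_\varphi$ be the completion of $A_\theta$ for $\langle a,b\rangle_\varphi=\varphi(b^*a)$. Let $\mathcal{H}^{(1,0)}$ be the completion of the space of finite sums $\sum a\,\partial b$ ($a,b\in A_\theta^\infty$) in the inner product $\langle a\,\partial b,a'\,\partial b'\rangle=\tau_0((\partial b')^*a'^*a\,\partial b)$. Let $\nabla_\varphi:\mathcal{H}_\varphi\to\mathcal{H}^{(1,0)}$ be the operator $\partial+w$ viewed as an unbounded operator between these spaces, and let $\nabla_\varphi^*$ be its adjoint. Then $\Delta'_0=\nabla_\varphi^*\nabla_\varphi$ and $\Delta'_1=\nabla_\varphi\nabla_\varphi^*$.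 The heat trace expansion is $\mathrm{Tr}(e^{-t\Delta'_i})\sim t^{-1}\sum_{n\ge0}B_{2n}(\Delta'_i)\,t^n$ as $t\to0^+$, for $i=0,1$. *)

(* Defs.v *)
(* MathComp and MathComp-Analysis; the complex numbers are R[i], R : realType. *)
From mathcomp Require Import all_boot all_order all_algebra.
From mathcomp Require Import complex.
From mathcomp Require Import all_classical all_reals all_analysis.
From mathcomp.analysis.showcase Require summability.

Set Implicit Arguments.
Unset Strict Implicit.
Unset Printing Implicit Defensive.

Import Order.TTheory GRing.Theory Num.Theory.
Import numFieldNormedType.Exports.

Local Open Scope classical_set_scope.
Local Open Scope complex_scope.
Local Open Scope ring_scope.

(* The formal series \sum_(m, n) a (m, n) U^m V^n. *)
Notation series2 R := ((int * int)%type -> R[i]).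

Section NoncommutativeTorus.
Variable R : realType.
Local Notation C := R[i].
Local Notation Z2 := (int * int)%type.

Local Notation series := (series2 R).

(* Unconditional sums, along the net of finite subsets of the index type. *)
Definition sums_to (I : choiceType) (f : I -> C) (s : C) : Prop :=
  summability.partial_sum f @ summability.totally --> (s : C^o).

Definition usum (I : choiceType) (f : I -> C) : C :=
  summability.sum (f : I -> C^o).

(* e^(2 pi i theta m) *)
Definition phase (theta : R) (m : int) : C :=
  cos (2 * pi * theta * m%:~R) +i* sin (2 * pi * theta * m%:~R).

(* V U = e^(2 pi i theta) U V gives
   U^a V^b U^c V^d = e^(2 pi i theta b c) U^(a+c) V^(b+d). *)
Definition ncmul (theta : R) (a b : series) : series :=
  fun p => usum (fun q : Z2 =>
    phase theta (q.2 * (p.1 - q.1)) * (a q * b (p - q))).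

(* (U^m V^n)^* = V^-n U^-m = e^(2 pi i theta m n) U^-m V^-n *)
Definition star (theta : R) (a : series) : series :=
  fun p => phase theta (p.1 * p.2) * (a (- p))^*.

Definition ncone : series := fun p => (p == 0)%:R.

Definition tau0 (a : series) : C := a 0.

(* The smooth subalgebra of A_theta: rapidly decreasing coefficients. *)
Definition smooth : set series :=
  [set a | forall N : nat, exists M : C, forall m n : int,
    (1 + `|m| + `|n|)%:~R ^+ N * `|a (m, n)| <= M].

(* The completion of A_theta for <a, b> = tau0 (b^* a): the U^m V^n are
   orthonormal, so its elements are the square-summable series. *)
Definition H0 : set series :=
  [set x | summable [set: Z2] (fun p => (complex.Re (`|x p| ^+ 2))%:E)].

Definition ip (theta : R) (a b : series) : C :=
  tau0 (ncmul theta (star theta b) a).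

(* A_theta acts faithfully on H0 by left multiplication, so that positivity
   in A_theta is positivity of the operator; 0 <= z in C contains z real. *)
Definition positive (theta : R) (k : series) : Prop :=
  forall x, H0 x -> 0 <= ip theta (ncmul theta k x) x.

Definition is_inverse (theta : R) (k kinv : series) : Prop :=
  [/\ smooth kinv, ncmul theta k kinv = ncone & ncmul theta kinv k = ncone].

(* phi a = tau0 (a k^-2), where k^-2 = e^-h for k = e^(h/2).  Since k is bounded
   with bounded inverse, <a, b>_phi = phi (b^* a) is equivalent to <a, b>, so
   the completion of A_theta for it is H0 as a space. *)
Definition ip_phi (theta : R) (kinv a b : series) : C :=
  tau0 (ncmul theta (ncmul theta (star theta b) a) (ncmul theta kinv kinv)).

(* Unbounded operators on H0 are given by their graphs; the composite S \; T of
   relations is S o T, on its maximal domain. *)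
Definition operator : Type := set (series * series).

Definition delta1 (x : series) : series := fun p => p.1%:~R * x p.
Definition delta2 (x : series) : series := fun p => p.2%:~R * x p.

(* dom delta1 `&` dom delta2 for the selfadjoint delta1, delta2 *)
Definition H1 : set series :=
  [set x | [/\ H0 x, H0 (delta1 x) & H0 (delta2 x)]].

(* delta1 + sigma delta2 + c; this is del + c for sigma = conj tau and
   del^* + c for sigma = tau *)
Definition dolbeault (sigma c : C) : operator :=
  [set p | H1 p.1 /\ p.2 = delta1 p.1 + sigma *: delta2 p.1 + c *: p.1].

Definition left_mul (theta : R) (a : series) : operator :=
  [set p | H0 p.1 /\ p.2 = ncmul theta a p.1].

(* Adjoint of S : (H0, ipd) -> (H0, ipc), for S densely defined. *)
Definition adjoint (ipd ipc : series -> series -> C) (S : operator)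
    : operator :=
  [set p | [/\ H0 p.1, H0 p.2 &
    forall x, S x -> ipc x.2 p.1 = ipd x.1 p.2]].

(* nabla_phi = del + w from H_phi to H^(1,0).  The inner product of H^(1,0)
   is <a del b, a' del b'> = ip (a del b) (a' del b'), and the sums of
   the a del b exhaust the smooth elements, since a = (a U^-1) del U; its
   completion is therefore H0 with the inner product ip. *)
Definition nabla (tau w : C) : operator := dolbeault tau^* w.

Definition nabla_adj (theta : R) (tau w : C) (kinv : series) : operator :=
  adjoint (ip_phi theta kinv) (ip theta) (nabla tau w).

(* The twisted Dolbeault Laplacians nabla^* nabla and nabla nabla^*, perturbed
   by the Weyl factor k with inverse kinv *)
Definition Delta0 (theta : R) (tau w : C) (kinv : series) : operator :=
  (nabla_adj theta tau w kinv \; nabla tau w)%relation.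

Definition Delta1 (theta : R) (tau w : C) (kinv : series) : operator :=
  (nabla tau w \; nabla_adj theta tau w kinv)%relation.

(* k (- conj w + conj del) (- w + del) k, with conj del = delta1 + tau delta2 *)
Definition model0 (theta : R) (tau w : C) (k : series) : operator :=
  (left_mul theta k \; (dolbeault tau (- w^*) \;
     (dolbeault tau^* (- w) \; left_mul theta k)))%relation.

(* (- conj w + conj del) k^2 (- w + del) *)
Definition model1 (theta : R) (tau w : C) (k : series) : operator :=
  (dolbeault tau (- w^*) \;
     (left_mul theta (ncmul theta k k) \; dolbeault tau^* (- w)))%relation.

Definition antiunitary_equiv (ip1 : series -> series -> C) (T1 : operator)
    (ip2 : series -> series -> C) (T2 : operator) : Prop :=
  exists W : series -> series,
    [/\ forall x, H0 x -> H0 (W x),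
        forall y, H0 y -> exists2 x, H0 x & W x = y,
        forall (c : C) x y, H0 x -> H0 y -> W (c *: x + y) = c^* *: W x + W y,
        forall x y, H0 x -> H0 y -> ip2 (W x) (W y) = (ip1 x y)^* &
        forall x y, H0 x -> H0 y -> T1 (x, y) <-> T2 (W x, W y)].

Section Heat.
Variable ipH : series -> series -> C.

Definition orthonormal_basis (I : choiceType) (e : I -> series) : Prop :=
  [/\ forall i, H0 (e i),
      forall i j, ipH (e i) (e j) = (i == j)%:R &
      forall x, H0 x -> (forall i, ipH x (e i) = 0) -> x = 0].

(* T is the selfadjoint operator with orthonormal eigenbasis e and
   eigenvalues lam, with its full domain. *)
Definition spectral_resolution (T : operator) (I : choiceType)
    (e : I -> series) (lam : I -> R) : Prop :=
  orthonormal_basis e /\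
  forall x y, T (x, y) <->
    [/\ H0 x, H0 y & forall i, ipH y (e i) = (lam i)%:C * ipH x (e i)].

(* E = e^(-t T), by functional calculus. *)
Definition is_heat_operator (T : operator) (t : R) (E : series -> series)
    : Prop :=
  exists (I : choiceType) (e : I -> series) (lam : I -> R),
    spectral_resolution T e lam /\
    forall x, H0 x -> H0 (E x) /\
      forall i, ipH (E x) (e i) = (expR (- t * lam i))%:C * ipH x (e i).

(* E is of trace class with trace v. *)
Definition is_trace (E : series -> series) (v : C) : Prop :=
  forall (I : choiceType) (e : I -> series), orthonormal_basis e ->
    sums_to (fun i => ipH (E (e i)) (e i)) v.

(* Tr (e^(-t T)) ~ t^-1 \sum_n B (2 n) t^n as t -> 0+; the odd-indexed entries
   of B play no role. *)
Definition heat_expansion (T : operator) (B : nat -> C) : Prop :=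
  exists Tr : R -> C,
    (forall t, 0 < t -> exists2 E, is_heat_operator T t E & is_trace E (Tr t)) /\
    forall N : nat, exists2 M : C, 0 <= M & \forall t \near (0 : R)^'+,
      `|Tr t - t%:C^-1 * \sum_(n < N) B n.*2 * t%:C ^+ n|
        <= M * (t%:C^-1 * t%:C ^+ N).

End Heat.
End NoncommutativeTorus.

(* Main.v *)
Require Import Defs.
From mathcomp Require Import all_boot all_order all_algebra.
From mathcomp Require Import complex finmap ring lra zify.
From mathcomp Require Import all_classical all_reals all_analysis.
Import Order.TTheory GRing.Theory Num.Theory.
Import numFieldNormedType.Exports.
Import ComplexField.Normc.

(** The equality of the coefficients is the McKean-Singer argument for the
    operator nabla = del + w.  The eigenvectors of Delta0 = nabla^* nabla with
    a nonzero eigenvalue lam are carried by nabla / sqrt lam to eigenvectors of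
    Delta1 = nabla nabla^* with the same eigenvalue.  On the monomials U^m V^n
    the operator nabla is the multiplication by m + conj tau n + w, which
    vanishes for at most one (m, n); since tau is not real this symbol is
    elliptic, its nonzero values are bounded below, and the range of nabla is
    closed.  The kernels of nabla and of its adjoint are thus spanned by the
    same monomial, if any: nabla has index 0.  Consequently an eigenbasis of
    Delta0 is transferred to an eigenbasis of Delta1 with the same index set
    and the same eigenvalues ([transfer_onb], [transfer_eigen]), and
    Tr (exp (-t Delta0)) equals Tr (exp (-t Delta1)) for every t > 0
    ([heat_traces_agree]).  The two expansions then have the same coefficients
    at t^-1 and t^0 ([heat_coeff2]).

    For the models: phi has density k^-2, so the adjoint of nabla is
    del^* + conj w followed by right multiplication by k^2 ([nabla_adjE]),
    right multiplication by k^-1 is unitary from H_phi onto H0, and the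
    involution is antiunitary, exchanges left and right multiplication, and
    sends del + w to - (del^* - conj w).  This gives [Delta0_equiv_model0] and
    [Delta1_equiv_model1]; it uses that k is selfadjoint, which positivity
    implies ([positive_star]).

    The analysis behind this is that of unconditional sums over the lattice:
    Fubini ([usum_swap]), Young's inequality for the product of a
    square-summable and a summable series ([H0_ncmul]), and associativity of
    the twisted product of two square-summable series and a summable one
    ([ncmulA]). *)

Local Open Scope classical_set_scope.
Local Open Scope complex_scope.
Local Open Scope ring_scope.
Set Implicit Arguments.
Unset Strict Implicit.

(** * Totals of non-negative families *)

Section Nonneg.
Variable R : realType.
Local Notation C := R[i].

(** Totals are taken in the extended reals, where rearrangement and Tonelli's
    theorem hold without any summability condition. *)
Definition finsum (I : choiceType) (f : I -> R) : Prop :=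
  (\esum_(i in [set: I]) (f i)%:E < +oo)%E.

Definition rsum (I : choiceType) (f : I -> R) : R :=
  fine (\esum_(i in [set: I]) (f i)%:E).

Section Basic.
Variable I : choiceType.
Implicit Types f g : I -> R.

Lemma rsumE f : (forall i, 0 <= f i) -> finsum f ->
  \esum_(i in [set: I]) (f i)%:E = (rsum f)%:E.
Proof.
move=> f0 ff; rewrite /rsum fineK// ge0_fin_numE//.
by apply: esum_ge0 => i _; rewrite lee_fin.
Qed.

Lemma rsum_ge0 f : (forall i, 0 <= f i) -> 0 <= rsum f.
Proof. by move=> f0; apply/fine_ge0/esum_ge0 => i _; rewrite lee_fin. Qed.

Lemma finsum_le f g : (forall i, f i <= g i) -> finsum g -> finsum f.
Proof.
by move=> fg; apply: le_lt_trans; apply: le_esum => i _; rewrite lee_fin.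
Qed.

(** The bound from above holds for every constant; applied to the inverse of c
    it gives the other bound. *)
Lemma esumZ (c : R) f : 0 <= c -> (forall i, 0 <= f i) ->
  \esum_(i in [set: I]) (c * f i)%:E =
  (c%:E * \esum_(i in [set: I]) (f i)%:E)%E.
Proof.
have le c' (g : I -> R) : 0 <= c' -> (forall i, 0 <= g i) ->
    (\esum_(i in [set: I]) (c' * g i)%:E <=
      c'%:E * \esum_(i in [set: I]) (g i)%:E)%E.
  move=> c0 g0; apply: ge_ereal_sup => _ [X [finX XI] <-].
  rewrite fsbig_finite//= sumEFin -mulr_sumr EFinM lee_wpmul2l ?lee_fin//.
  by apply: ereal_sup_ubound; exists X => //; rewrite fsbig_finite//= sumEFin.
rewrite le_eqVlt => /orP[/eqP<- f0|c0 f0].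
  by rewrite mul0e; apply: esum1 => i _; rewrite mul0r.
apply/eqP; rewrite eq_le le ?(ltW c0)//=.
have /le : 0 <= c^-1 by rewrite invr_ge0 ltW.
move=> /(_ (fun i => c * f i)) h.
have {h} : (\esum_(i in [set: I]) (f i)%:E <=
   c^-1%:E * \esum_(i in [set: I]) (c * f i)%:E)%E.
  rewrite (le_trans _ (h _))//; last by move=> i; rewrite mulr_ge0 ?(ltW c0).
  by apply: le_esum => i _; rewrite mulKf ?gt_eqF.
by move=> h; rewrite muleC -lee_pdivlMr// muleC.
Qed.

Lemma finsumZ c f : 0 <= c -> (forall i, 0 <= f i) -> finsum f ->
  finsum (fun i => c * f i).
Proof. by move=> c0 f0 ff; rewrite /finsum esumZ// rsumE// -EFinM ltry. Qed.

Lemma rsumZ c f : 0 <= c -> (forall i, 0 <= f i) -> finsum f ->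
  rsum (fun i => c * f i) = c * rsum f.
Proof. by move=> c0 f0 ff; rewrite /rsum esumZ// rsumE// -EFinM. Qed.

Let esumDr f g : (forall i, 0 <= f i) -> (forall i, 0 <= g i) ->
  \esum_(i in [set: I]) (f i + g i)%:E =
  (\esum_(i in [set: I]) (f i)%:E + \esum_(i in [set: I]) (g i)%:E)%E.
Proof. by move=> f0 g0; rewrite -esumD// => i _; rewrite lee_fin. Qed.

Lemma finsumD f g : (forall i, 0 <= f i) -> (forall i, 0 <= g i) ->
  finsum f -> finsum g -> finsum (fun i => f i + g i).
Proof.
move=> f0 g0 ff fg; rewrite /finsum.
by rewrite esumDr// !rsumE// -EFinD ltry.
Qed.

Lemma rsumD f g : (forall i, 0 <= f i) -> (forall i, 0 <= g i) ->
  finsum f -> finsum g -> rsum (fun i => f i + g i) = rsum f + rsum g.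
Proof.
move=> f0 g0 ff fg; rewrite {1}/rsum.
by rewrite esumDr// !rsumE.
Qed.

Lemma rsum_ge f (A : {fset I}) : (forall i, 0 <= f i) -> finsum f ->
  \sum_(i <- A) f i <= rsum f.
Proof.
move=> f0 ff; rewrite -lee_fin -rsumE// -sumEFin; apply: esum_ge.
by exists [set` A] => //; rewrite fsbig_finite//= set_fsetK.
Qed.

Lemma rsum_eq0 f : (forall i, 0 <= f i) -> finsum f -> rsum f = 0 ->
  forall i, f i = 0.
Proof.
move=> f0 ff s0 i; apply/eqP; rewrite eq_le f0 andbT -s0.
by apply: le_trans (rsum_ge [fset i]%fset f0 ff); rewrite big_seq_fset1.
Qed.

Lemma rsum_sup f e : (forall i, 0 <= f i) -> finsum f -> 0 < e ->
  exists A : {fset I}, rsum f - e < \sum_(i <- A) f i.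
Proof.
move=> f0 ff e0.
have : ((rsum f - e)%:E < \esum_(i in [set: I]) (f i)%:E)%E.
  by rewrite rsumE// lte_fin ltrBlDr ltrDl.
move=> /ereal_sup_gt[_ [X [finX _] <-]].
by rewrite fsbig_finite//= sumEFin lte_fin => h; exists (fset_set X).
Qed.

End Basic.

Lemma rsum_reindex (I J : choiceType) (e : I -> J) (f : J -> R) : bijective e ->
  rsum (fun i => f (e i)) = rsum f.
Proof.
move=> be; rewrite /rsum -(reindex_esum setT setT e (fun j => (f j)%:E))//.
by rewrite setTT_bijective.
Qed.

Lemma finsum_reindex (I J : choiceType) (e : I -> J) (f : J -> R) :
  bijective e -> finsum f -> finsum (fun i => f (e i)).
Proof.
move=> be; rewrite /finsum -(reindex_esum setT setT e (fun j => (f j)%:E))//.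
by rewrite setTT_bijective.
Qed.

Lemma finsum_pair (I J : choiceType) (f : I * J -> R) :
  (forall p, 0 <= f p) -> finsum f ->
  [/\ forall i, finsum (fun j => f (i, j)),
      finsum (fun i => rsum (fun j => f (i, j))) &
      rsum (fun i => rsum (fun j => f (i, j))) = rsum f].
Proof.
move=> f0 ff.
have E : \esum_(i in [set: I]) \esum_(j in [set: J]) (f (i, j))%:E =
   \esum_(p in [set: I * J]) (f p)%:E.
  rewrite (@esum_esum R I J setT (fun=> setT) (fun i j => (f (i, j))%:E));
    last by move=> *; rewrite lee_fin.
  rewrite (_ : _ `*`` _ = setT); last by apply/seteqP; split.
  by apply: eq_esum => -[].
have fj i : finsum (fun j => f (i, j)).
  apply: le_lt_trans ff; rewrite -E.
  rewrite [leRHS](esumID [set i]); last first.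
    by move=> i' _; apply: esum_ge0 => j _; rewrite lee_fin.
  rewrite setTI esum_set1; last by apply: esum_ge0 => j _; rewrite lee_fin.
  rewrite leeDl//; apply: esum_ge0 => i' _.
  by apply: esum_ge0 => j _; rewrite lee_fin.
have E' : \esum_(i in [set: I]) (rsum (fun j => f (i, j)))%:E =
   \esum_(p in [set: I * J]) (f p)%:E.
  by rewrite -E; apply: eq_esum => i _; rewrite rsumE.
by split => //; rewrite /finsum /rsum ?E'.
Qed.

(** The slice at i is a multiple of a rearrangement of b, so Tonelli's theorem
    gives the product of the totals of a and b.  With phi i j = j - i this is
    the summability behind all the convolution estimates below. *)
Lemma finsum_prod (I J : choiceType) (a : I -> R) (b : J -> R)
    (phi : I -> J -> J) :
  (forall i, bijective (phi i)) ->
  (forall i, 0 <= a i) -> (forall j, 0 <= b j) -> finsum a -> finsum b ->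
  finsum (fun p => a p.1 * b (phi p.1 p.2)).
Proof.
move=> bphi a0 b0 fa fb; rewrite /finsum.
rewrite (_ : [set: I * J] = [set: I] `*`` (fun=> setT)); last first.
  by apply/seteqP; split.
rewrite -(@esum_esum R I J setT (fun=> setT)
  (fun i j => (a i * b (phi i j))%:E)); last first.
  by move=> i j _ _; rewrite lee_fin mulr_ge0.
have E i : \esum_(j in [set: J]) (a i * b (phi i j))%:E = (rsum b * a i)%:E.
  rewrite esumZ// rsumE//; last exact: finsum_reindex.
  by rewrite rsum_reindex// -EFinM mulrC.
under eq_esum do rewrite E.
by rewrite esumZ ?rsum_ge0// rsumE// -EFinM ltry.
Qed.

Lemma normc_ge0 (z : C) : 0 <= normc z.
Proof. by case: z => a b /=; rewrite sqrtr_ge0. Qed.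

Lemma normc_real (x : R) : normc x%:C = `|x|.
Proof. by rewrite /normc/= expr0n addr0 sqrtr_sqr. Qed.

Lemma normE (z : C) : `|z| = (normc z)%:C. Proof. by []. Qed.

Lemma normc_conj (z : C) : normc z^* = normc z.
Proof. by case: z => a b; rewrite /= sqrrN. Qed.

Lemma normr_Re (z : C) : `|complex.Re z| <= normc z.
Proof. by have := normc_ge_Re z; rewrite normE lecR. Qed.

Lemma normr_Im (z : C) : `|complex.Im z| <= normc z.
Proof.
rewrite (_ : normc z = normc (z * 'i)); last first.
  by rewrite normcM {3}/normc/= expr0n expr1n add0r sqrtr1 mulr1.
by have := normr_Re (z * 'i); rewrite ReiNIm normrN.
Qed.

Lemma mulCJ (z : C) : z * z^* = (normc z ^+ 2)%:C.
Proof. by rewrite -normCK normE -rmorphXn. Qed.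

Lemma ltr0c (x : R) : ((0 : C) < x%:C) = (0 < x).
Proof. exact: ltcR. Qed.

Lemma sums_toP (I : choiceType) (f : I -> C) s :
  sums_to f s <-> forall e : R, 0 < e -> exists A : {fset I},
    forall B : {fset I}, (A `<=` B)%fset -> normc (s - \sum_(i <- B) f i) < e.
Proof.
have tF : Filter (@summability.totally I).
  exact: (@filter_filter _ _ summability.totally_filter).
rewrite /sums_to; split.
  move=> /(@cvgrPdist_lt C C^o) h e e0.
  have /h[A _ AB] : (0 : C) < e%:C by rewrite ltr0c.
  exists A => B /AB /=; rewrite /summability.partial_sum big_seq_fsetE/=.
  by rewrite normE ltcR.
move=> h; apply/(@cvgrPdist_lt C C^o) => e e0.
have eE : e = (complex.Re e)%:C by rewrite RRe_real// ger0_real// ltW.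
have : 0 < complex.Re e by rewrite -ltr0c -eE.
move=> /h[A AB]; exists A => // B /AB.
by rewrite /summability.partial_sum big_seq_fsetE/= normE eE ltcR.
Qed.

End Nonneg.

(** * Unconditional complex sums *)

Section CSums.
Variable R : realType.
Local Notation C := R[i].

Definition l1 (I : choiceType) (f : I -> C) : Prop :=
  finsum (fun i => normc (f i)).

Section Basic.
Variable I : choiceType.
Implicit Types f g : I -> C.

Lemma sums_to_usum f s : sums_to f s -> usum f = s.
Proof.
have tF := @summability.totally_filter I.
by move=> fs; apply: (@cvg_lim C^o) fs; apply: norm_hausdorff.
Qed.

Lemma sums_to_uniq f s t : sums_to f s -> sums_to f t -> s = t.
Proof. by move=> /sums_to_usum <- /sums_to_usum. Qed.

Lemma sums_to_lin c f g s t : sums_to f s -> sums_to g t ->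
  sums_to (fun i => c * f i + g i) (c * s + t).
Proof.
move=> /sums_toP fs /sums_toP gt; apply/sums_toP => e e0.
have c0 : 0 < normc c + 1 by rewrite ltr_wpDl ?normc_ge0.
have [|A fA] := fs (e / 2 / (normc c + 1)); first by rewrite !divr_gt0.
have [|B gB] := gt (e / 2); first by rewrite divr_gt0.
exists (A `|` B)%fset => D; rewrite fsubUset => /andP[/fA fD /gB gD].
rewrite big_split/= -mulr_sumr opprD addrACA -mulrBr.
rewrite (le_lt_trans (le_normcD _ _))// normcM (splitr e) ler_ltD//.
rewrite ltr_pdivlMr// in fD.
apply: le_trans (ltW fD); rewrite mulrC ler_wpM2l ?normc_ge0//.
by rewrite lerDl.
Qed.

(** The partial sums increase with the finite set, so their supremum is their
    limit along the net. *)
Lemma sums_to_rsum (f : I -> R) : (forall i, 0 <= f i) -> finsum f ->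
  sums_to (fun i => (f i)%:C) (rsum f)%:C.
Proof.
move=> f0 ff; apply/sums_toP => e e0.
have [A hA] := rsum_sup f0 ff e0; exists A => B AB.
have -> : (rsum f)%:C - \sum_(i <- B) (f i)%:C = (rsum f - \sum_(i <- B)
  f i)%:C.
  by rewrite rmorphB rmorph_sum.
rewrite normc_real ger0_norm.
  rewrite ltrBlDr -ltrBlDl (lt_le_trans hA)//.
  pose F i := if i \in A then f i else 0.
  rewrite (_ : \sum_(i <- A) f i = \sum_(i <- A) F i); last first.
    by apply: eq_big_seq => i iA; rewrite /F iA.
  rewrite (big_fset_incl _ AB) => [|i _ /negPf iA]; last by rewrite /F iA.
  by apply: ler_sum => i _; rewrite /F; case: ifP.
by rewrite subr_ge0 rsum_ge.
Qed.

Lemma l1D c f g : l1 f -> l1 g -> l1 (fun i => c * f i + g i).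
Proof.
move=> ff fg.
apply: (@finsum_le _ _ _ (fun i => normc c * normc (f i) + normc (g i))).
  by move=> i; rewrite (le_trans (le_normcD _ _))// normcM.
apply: finsumD => //; first by move=> i; rewrite mulr_ge0 ?normc_ge0.
- by move=> i; exact: normc_ge0.
- by apply: finsumZ => // *; exact: normc_ge0.
Qed.

Lemma l1_real (f : I -> R) : (forall i, 0 <= f i) ->
  l1 (fun i => (f i)%:C) = finsum f.
Proof.
move=> f0; rewrite /l1; congr finsum; apply/funext => i.
by rewrite normc_real ger0_norm.
Qed.

(** A summable family is a combination of the positive and negative parts of
    its real and imaginary parts.  Any property stable under combinations is
    thereby reduced to non-negative families, where it is a statement about
    totals. *)
Lemma l1_ind (P : (I -> C) -> Prop) :
  (forall f : I -> R, (forall i, 0 <= f i) -> finsum f ->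
    P (fun i => (f i)%:C)) ->
  (forall c f g, l1 f -> l1 g -> P f -> P g -> P (fun i => c * f i + g i)) ->
  forall f, l1 f -> P f.
Proof.
move=> P0 PD f lf.
pose Q g := l1 g /\ P g.
have Q0 (h : I -> R) : (forall i, 0 <= h i) -> (forall i, h i <= normc (f i)) ->
    Q (fun i => (h i)%:C).
  move=> h0 hf; have fh : finsum h by exact: finsum_le lf.
  by split; [rewrite l1_real|apply: P0].
have QD c g h : Q g -> Q h -> Q (fun i => c * g i + h i).
  by move=> [lg Pg] [lh Ph]; split; [exact: l1D|exact: PD].
have mx (x m : R) : `|x| <= m -> Num.max x 0 <= m.
  by rewrite ge_max => h; rewrite (le_trans (ler_norm _) h) (le_trans _ h).
have mx' (x m : R) : `|x| <= m -> Num.max (- x) 0 <= m.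
  by move=> ?; apply: mx; rewrite normrN.
have m0 (x : R) : 0 <= Num.max x 0 by rewrite le_max lexx orbT.
have M (x : R) : x = Num.max x 0 - Num.max (- x) 0.
  have [x0|x0] := leP 0 x; first by rewrite max_r ?subr0// oppr_le0.
  by rewrite max_l ?sub0r ?opprK// oppr_ge0 ltW.
suff : Q (fun i => 1 * (Num.max (complex.Re (f i)) 0)%:C +
   ((- 1) * (Num.max (- complex.Re (f i)) 0)%:C +
   ('i * (Num.max (complex.Im (f i)) 0)%:C +
   ((- 'i) * (Num.max (- complex.Im (f i)) 0)%:C + 0%:C)))).
  rewrite (_ : (fun i => _) = f); first by case.
  apply/funext => i; rewrite addr0 mul1r mulN1r mulNr addrA -mulrBr.
  by rewrite -!rmorphB/= -!M -complexE.
have QDr c (h : I -> R) g : (forall i, 0 <= h i) ->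
    (forall i, h i <= normc (f i)) -> Q g -> Q (fun i => c * (h i)%:C + g i).
  by move=> h0 hf; exact: (QD c (fun i => (h i)%:C)) (Q0 _ h0 hf).
apply: (QDr 1 (fun i => Num.max (complex.Re (f i)) 0)).
- by [].
- by move=> i; exact/mx/normr_Re.
apply: (QDr (-1) (fun i => Num.max (- complex.Re (f i)) 0)).
- by [].
- by move=> i; exact/mx'/normr_Re.
apply: (QDr 'i (fun i => Num.max (complex.Im (f i)) 0)).
- by [].
- by move=> i; exact/mx/normr_Im.
apply: (QDr (- 'i) (fun i => Num.max (- complex.Im (f i)) 0)).
- by [].
- by move=> i; exact/mx'/normr_Im.
by apply: (Q0 (fun=> 0)) => // i; exact: normc_ge0.
Qed.

Lemma sums_to_l1 f : l1 f -> sums_to f (usum f).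
Proof.
move=> lf; suff [s fs] : exists s, sums_to f s by rewrite (sums_to_usum fs).
elim/l1_ind: lf => {f} [f f0 ff|c f g _ _ [s fs] [t gt]].
  by exists (rsum f)%:C; exact: sums_to_rsum.
by exists (c * s + t); exact: sums_to_lin.
Qed.

Lemma usum_lin c f g : l1 f -> l1 g ->
  usum (fun i => c * f i + g i) = c * usum f + usum g.
Proof. by move=> lf lg; apply/sums_to_usum/sums_to_lin; exact: sums_to_l1. Qed.

Lemma usum_real (f : I -> R) : (forall i, 0 <= f i) -> finsum f ->
  usum (fun i => (f i)%:C) = (rsum f)%:C.
Proof. by move=> f0 ff; apply/sums_to_usum/sums_to_rsum. Qed.

Lemma l1_0 : l1 (fun _ : I => 0).
Proof. by rewrite /l1 /finsum normc0 esum1. Qed.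

Lemma usum0 : usum (fun _ : I => 0) = 0 :> C.
Proof.
have := @usum_real (fun=> 0); rewrite /finsum /rsum esum1//.
by move=> ->.
Qed.

Lemma usumZ c f : l1 f -> usum (fun i => c * f i) = c * usum f.
Proof.
move=> lf; have := usum_lin c lf l1_0; rewrite usum0 addr0 => <-.
by congr usum; apply/funext => i; rewrite addr0.
Qed.

Lemma usum_norm f (G : I -> R) : (forall i, normc (f i) <= G i) -> finsum G ->
  normc (usum f) <= rsum G.
Proof.
move=> fG fG'; have lf : l1 f by exact: finsum_le fG'.
have G0 i : 0 <= G i by rewrite (le_trans (normc_ge0 _) (fG i)).
apply/ler_addgt0Pl => e e0.
have /sums_toP/(_ _ e0)[A /(_ A (fsubset_refl _)) hA] := sums_to_l1 lf.
rewrite -(subrK (\sum_(i <- A) f i) (usum f)).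
rewrite (le_trans (le_normcD _ _))// lerD ?(ltW hA)//.
apply: le_trans (rsum_ge A G0 fG').
elim/big_ind2 : _ => [|x1 x2 y1 y2 h1 h2|//]; first by rewrite normc0.
by rewrite (le_trans (le_normcD _ _))// lerD.
Qed.

Lemma l1J f : l1 f -> l1 (fun i => (f i)^*).
Proof. by rewrite /l1; congr finsum; apply/funext => i; rewrite normc_conj. Qed.

Lemma usumJ f : l1 f -> usum (fun i => (f i)^*) = (usum f)^*.
Proof.
move=> lf; apply: sums_to_usum; have /sums_toP h := sums_to_l1 lf.
apply/sums_toP => e /h[A hA]; exists A => B /hA.
by rewrite -rmorph_sum -rmorphB normc_conj.
Qed.

Lemma l1_single f x0 : (forall i, i != x0 -> f i = 0) -> l1 f.
Proof.
move=> f0; rewrite /l1 /finsum (esumID [set x0]); last first.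
  by move=> i _; rewrite lee_fin normc_ge0.
rewrite setTI esum_set1 ?lee_fin ?normc_ge0// esum1 ?adde0 ?ltry//.
by move=> i [_ /eqP ix]; rewrite f0 ?normc0.
Qed.

Lemma usum_single f x0 : (forall i, i != x0 -> f i = 0) -> usum f = f x0.
Proof.
move=> f0; apply: sums_to_usum; apply/sums_toP => e e0.
exists [fset x0]%fset => B AB.
rewrite -(big_fset_incl _ AB).
  by rewrite big_seq_fset1 subrr normc0.
by move=> i _; rewrite inE => /f0.
Qed.

End Basic.
End CSums.

(** * Reindexing and Fubini *)

Section Fubini.
Variable R : realType.
Local Notation C := R[i].

Lemma l1_reindex (I J : choiceType) (e : I -> J) (f : J -> C) : bijective e ->
  l1 f -> l1 (fun i => f (e i)).
Proof. exact: (finsum_reindex (f := fun i => normc (f i))). Qed.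

Lemma usum_reindex (I J : choiceType) (e : I -> J) (f : J -> C) : bijective e ->
  l1 f -> usum (fun i => f (e i)) = usum f.
Proof.
move=> be; elim/l1_ind => {f} [f f0 ff|c f g lf lg IHf IHg].
  rewrite !usum_real ?rsum_reindex//; exact: finsum_reindex.
by rewrite !usum_lin ?IHf ?IHg//; exact: l1_reindex.
Qed.

Variables I J : choiceType.
Implicit Types f : I * J -> C.

Lemma l1_slice f i : l1 f -> l1 (fun j => f (i, j)).
Proof.
by move=> lf; have [h _ _] := finsum_pair (fun p => normc_ge0 (f p)) lf;
  exact: h.
Qed.

Lemma l1_usum f : l1 f -> l1 (fun i => usum (fun j => f (i, j))).
Proof.
move=> lf; have [_ h _] := finsum_pair (fun p => normc_ge0 (f p)) lf.
by apply: finsum_le h => i; apply: usum_norm => //; exact: l1_slice.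
Qed.

Lemma usum_pair f : l1 f -> usum (fun i => usum (fun j => f (i, j))) = usum f.
Proof.
elim/l1_ind => {f} [f f0 ff|c f g lf lg IHf IHg].
  have [f1 f2 f3] := finsum_pair f0 ff.
  rewrite [RHS]usum_real// -f3 -usum_real//; last by move=> i; exact: rsum_ge0.
  by congr usum; apply/funext => i; rewrite usum_real.
rewrite usum_lin// -IHf -IHg -usum_lin; [|exact: l1_usum..].
by congr usum; apply/funext => i; rewrite usum_lin//; exact: l1_slice.
Qed.

End Fubini.

Section Swap.
Variable R : realType.
Local Notation C := R[i].

Lemma l1_swap (I J : choiceType) (f : I * J -> C) :
  l1 f -> l1 (fun p : J * I => f (p.2, p.1)).
Proof.
apply: (l1_reindex (e := fun p : J * I => (p.2, p.1))).
by exists (fun p => (p.2, p.1)) => -[].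
Qed.

Lemma usum_swap (I J : choiceType) (f : I * J -> C) : l1 f ->
  usum (fun i => usum (fun j => f (i, j))) =
  usum (fun j => usum (fun i => f (i, j))).
Proof.
move=> lf; rewrite usum_pair//.
rewrite (usum_pair (f := fun p : J * I => f (p.2, p.1))); last exact: l1_swap.
rewrite (usum_reindex (e := fun p : J * I => (p.2, p.1)))//.
by exists (fun p => (p.2, p.1)) => -[].
Qed.

End Swap.

(** * Square-summable series and the twisted product *)

Section Phase.
Variable R : realType.
Variable theta : R.
Local Notation phase := (phase theta).

Lemma phase0 : phase 0 = 1.
Proof. by rewrite /Defs.phase mulr0 cos0 sin0. Qed.

Lemma phaseD m n : phase (m + n) = phase m * phase n.
Proof.
rewrite /Defs.phase intrD mulrDr cosD sinD; simpc.
by congr Complex; rewrite addrC.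
Qed.

Lemma phaseN m : phase (- m) = (phase m)^*.
Proof. by rewrite /Defs.phase mulrNz mulrN cosN sinN. Qed.

Lemma normc_phase m : normc (phase m) = 1.
Proof. by rewrite /normc /= cos2Dsin2 sqrtr1. Qed.

End Phase.

Section L2.
Variable R : realType.
Local Notation C := R[i].
Local Notation Z2 := (int * int)%type.
Implicit Types x y : series2 R.

Lemma H0E x : H0 x <-> finsum (fun p => normc (x p) ^+ 2).
Proof.
rewrite /H0/= /summable /finsum.
rewrite (@eq_esum _ _ _ _ (fun p => (normc (x p) ^+ 2)%:E))//.
move=> p _; rewrite mulr0 subr0 -expr2/= ger0_norm//.
by rewrite exprn_ge0// normc_ge0.
Qed.

Lemma H0_le c x y : 0 <= c -> (forall p, normc (y p) <= c * normc (x p)) ->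
  H0 x -> H0 y.
Proof.
move=> c0 yx /H0E fx; apply/H0E.
apply: (@finsum_le _ _ _ (fun p => c ^+ 2 * normc (x p) ^+ 2)).
  by move=> p; rewrite -exprMn ler_pXn2r ?nnegrE ?mulr_ge0 ?normc_ge0.
by apply: finsumZ => // [|p]; rewrite exprn_ge0// normc_ge0.
Qed.

Lemma H0D x y : H0 x -> H0 y -> H0 (x + y).
Proof.
move=> /H0E fx /H0E fy; apply/H0E.
have sq0 (z : series2 R) p : 0 <= 2 * normc (z p) ^+ 2.
  by rewrite mulr_ge0// exprn_ge0// normc_ge0.
apply: (@finsum_le _ _ _
  (fun p => 2 * normc (x p) ^+ 2 + 2 * normc (y p) ^+ 2)).
  move=> p; apply: (@le_trans _ _ ((normc (x p) + normc (y p)) ^+ 2)).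
    by rewrite ler_pXn2r ?nnegrE ?addr_ge0 ?normc_ge0// le_normcD.
  by have := sqr_ge0 (normc (x p) - normc (y p)); nra.
apply: finsumD => //; apply: finsumZ => // p; rewrite exprn_ge0// normc_ge0//.
Qed.

Lemma H0Z c x : H0 x -> H0 (c *: x).
Proof.
apply: (@H0_le (normc c)); first exact: normc_ge0.
by move=> p; rewrite normcM.
Qed.

Lemma H0_reindex (e : Z2 -> Z2) x : bijective e -> H0 x ->
  H0 (fun p => x (e p)).
Proof.
move=> be /H0E fx; apply/H0E.
exact: (finsum_reindex (f := fun i => normc (x i) ^+ 2)).
Qed.

Lemma l1_mul x y : H0 x -> H0 y -> l1 (fun p => x p * y p).
Proof.
move=> /H0E fx /H0E fy.
apply: (@finsum_le _ _ _ (fun p => normc (x p) ^+ 2 + normc (y p) ^+ 2)).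
  move=> p; rewrite normcM.
  have := sqr_ge0 (normc (x p) - normc (y p)).
  by have := sqr_ge0 (normc (x p) + normc (y p)); nra.
by apply: finsumD => // p; rewrite exprn_ge0// normc_ge0.
Qed.

Lemma H0_l1 x : l1 x -> H0 x.
Proof.
move=> lx; apply/H0E.
apply: (@finsum_le _ _ _ (fun p => rsum (fun q => normc (x q)) * normc (x p))).
  move=> p; rewrite expr2 ler_wpM2r ?normc_ge0//.
  apply: le_trans (rsum_ge [fset p]%fset _ lx); rewrite ?big_seq_fset1//.
  by move=> q; exact: normc_ge0.
apply: finsumZ => //; first by apply: rsum_ge0 => q; exact: normc_ge0.
by move=> q; exact: normc_ge0.
Qed.

Lemma subl_bij (p : Z2) : bijective (fun q => p - q).
Proof. by apply: inv_bij => q; rewrite opprB addrC subrK. Qed.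

Lemma addl_bij (p : Z2) : bijective (fun q => p + q).
Proof. by exists (fun q => q - p) => q; rewrite ?(addrC p) ?addrK ?subrK. Qed.

Lemma opp_bij : bijective (fun q : Z2 => - q).
Proof. by apply: inv_bij => q; rewrite opprK. Qed.

Section Mul.
Variable theta : R.
Local Notation ncmul := (ncmul theta).
Local Notation star := (star theta).
Local Notation phase := (phase theta).

Lemma l1_phase (I : choiceType) (m : I -> int) (f : I -> C) :
  l1 f -> l1 (fun i => phase (m i) * f i).
Proof.
rewrite /l1; congr finsum; apply/funext => i.
by rewrite normcM normc_phase mul1r.
Qed.

Lemma l1_conv p a b : H0 a -> H0 b ->
  l1 (fun q : Z2 => phase (q.2 * (p.1 - q.1)) * (a q * b (p - q))).
Proof.
move=> ha hb; apply: l1_phase; apply: l1_mul => //.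
exact: (H0_reindex (subl_bij p)).
Qed.

Lemma ncmulDl c a a' b : H0 a -> H0 a' -> H0 b ->
  ncmul (c *: a + a') b = c *: ncmul a b + ncmul a' b.
Proof.
move=> ha ha' hb; apply/funext => p.
rewrite [RHS](_ : _ = c * ncmul a b p + ncmul a' b p)// /Defs.ncmul.
rewrite -usum_lin; [|exact: l1_conv..].
congr usum; apply/funext => q.
by rewrite [(c *: a + a') q](_ : _ = c * a q + a' q)//; ring.
Qed.

Lemma H0_star x : H0 x -> H0 (star x).
Proof.
move=> hx; apply: (H0_le ler01) (H0_reindex opp_bij hx) => p.
by rewrite normcM normc_phase !mul1r normc_conj.
Qed.

Lemma l1_star x : l1 x -> l1 (star x).
Proof. by move=> lx; apply/l1_phase/l1J/(l1_reindex opp_bij). Qed.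

Lemma starK x : star (star x) = x.
Proof.
apply/funext => p; rewrite /Defs.star rmorphM/= conjCK opprK mulrA.
by rewrite mulrNN mulCJ normc_phase expr1n mul1r.
Qed.

Lemma starDl c x y : star (c *: x + y) = c^* *: star x + star y.
Proof.
apply/funext => p.
rewrite [RHS](_ : _ = c^* * star x p + star y p)// /Defs.star.
by rewrite [(c *: x + y) (- p)](_ : _ = c * x (- p) + y (- p))//
  rmorphD rmorphM/=; ring.
Qed.

Lemma star_ncmul a b : H0 a -> H0 b ->
  star (ncmul a b) = ncmul (star b) (star a).
Proof.
move=> ha hb; apply/funext => p; rewrite {1}/Defs.star /Defs.ncmul.
rewrite -usumJ; last exact: l1_conv.
rewrite -usumZ; last exact/l1J/l1_conv.
rewrite -(usum_reindex (addl_bij p) (l1_conv p (H0_star hb) (H0_star ha))).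
congr usum; apply/funext => q.
rewrite /Defs.star !rmorphM/= -phaseN.
rewrite [- (p - _)](_ : _ = q); last by rewrite opprB addrC addrA addNr add0r.
rewrite -(opprD p q); case: p q => [p1 p2] [q1 q2] /=.
set A := (a _)^*; set B := (b _)^*.
transitivity (phase (p1 * p2 + - (q2 * (- p1 - q1))) * (A * B)).
  by rewrite phaseD; ring.
transitivity (phase ((p2 + q2) * (p1 - (p1 + q1)) + (p1 + q1) * (p2 + q2) +
    (p1 - (p1 + q1)) * (p2 - (p2 + q2))) * (A * B)); last first.
  by rewrite !phaseD; ring.
by congr (phase _ * _); ring.
Qed.

Definition monomial (p : Z2) : series2 R := fun q => (q == p)%:R.

Lemma ip_sum a b : H0 a -> H0 b -> ip theta a b = usum (fun p => a p * (b p)^*).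
Proof.
move=> ha hb; rewrite /ip /tau0 /Defs.ncmul.
rewrite -(usum_reindex opp_bij (l1_conv 0 (H0_star hb) ha)).
congr usum; apply/funext => -[q1 q2]; rewrite /Defs.star sub0r !opprK/=.
rewrite -mulrA mulrA -phaseD (_ : _ + _ = 0); last by ring.
by rewrite phase0 mul1r mulrC add0r.
Qed.

Lemma l1_ncmul a b : l1 a -> l1 b -> l1 (ncmul a b).
Proof.
move=> la lb; pose f (u : Z2 * Z2) := normc (a u.2) * normc (b (u.1 - u.2)).
have f0 u : 0 <= f u by rewrite mulr_ge0 ?normc_ge0.
have ff : finsum f.
  have := @finsum_prod _ _ _ (fun p => normc (a p)) (fun p => normc (b p))
    (fun q p => p - q).
  move=> /(_ _ (fun=> normc_ge0 _) (fun=> normc_ge0 _) la lb) h.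
  have {h} : finsum (fun u : Z2 * Z2 => normc (a u.1) * normc (b (u.2 - u.1))).
    apply: h => q; by exists (fun p => p + q) => p; rewrite ?addrK ?subrK.
  move=> /(finsum_reindex (e := fun u : Z2 * Z2 => (u.2, u.1))); apply.
  by exists (fun u => (u.2, u.1)) => -[].
have [fs ft _] := finsum_pair f0 ff.
apply: finsum_le ft => p; apply: usum_norm (fs p) => q.
by rewrite !normcM normc_phase mul1r.
Qed.

(** Young's inequality.  Write s for the modulus of a coefficient of a b, S1 for
    the sum of |b|, and S2 for the sum of |a|^2 |b| entering that coefficient.
    Summing 2 u |a| |b| <= |a|^2 |b| + u^2 |b| gives 2 u s <= S2 + u^2 S1 for
    every u >= 0, hence s^2 <= (S1 + 1) S2, and S2 is summable by Tonelli's
    theorem. *)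
Lemma H0_ncmul a b : H0 a -> l1 b -> H0 (ncmul a b).
Proof.
move=> /H0E fa lb.
pose f (u : Z2 * Z2) := normc (a u.2) ^+ 2 * normc (b (u.1 - u.2)).
have f0 u : 0 <= f u by rewrite mulr_ge0 ?exprn_ge0 ?normc_ge0.
have ff : finsum f.
  have := @finsum_prod _ _ _ (fun p => normc (a p) ^+ 2) (fun p => normc (b p))
    (fun q p => p - q).
  move=> /(_ _ (fun=> exprn_ge0 _ (normc_ge0 _)) (fun=> normc_ge0 _) fa lb) h.
  have {h} : finsum (fun u : Z2 * Z2 =>
      normc (a u.1) ^+ 2 * normc (b (u.2 - u.1))).
    apply: h => q; by exists (fun p => p + q) => p; rewrite ?addrK ?subrK.
  move=> /(finsum_reindex (e := fun u : Z2 * Z2 => (u.2, u.1))); apply.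
  by exists (fun u => (u.2, u.1)) => -[].
have [fs ft _] := finsum_pair f0 ff.
set S1 := rsum (fun q => normc (b q)).
have S10 : 0 <= S1 by apply: rsum_ge0 => q; exact: normc_ge0.
apply/H0E.
apply: (@finsum_le _ _ _ (fun p => (S1 + 1) * rsum (fun q => f (p, q))));
  last first.
  apply: finsumZ => //; first by rewrite addr_ge0.
  by move=> p; apply: rsum_ge0.
move=> p; set S2 := rsum _; set s := normc _.
have s0 : 0 <= s by exact: normc_ge0.
have S20 : 0 <= S2 by apply: rsum_ge0.
have lbp : finsum (fun q => normc (b (p - q))).
  exact: (finsum_reindex (f := fun q => normc (b q)) (subl_bij p)).
have S1E : rsum (fun q => normc (b (p - q))) = S1.
  exact: (rsum_reindex (fun q => normc (b q)) (subl_bij p)).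
have S11 : 0 < S1 + 1 by rewrite ltr_wpDl.
(* Adding 1 to S1 keeps the optimal u = s / S1 meaningful when S1 = 0. *)
have [u u0 us] : exists2 u, 0 <= u & s = u * (S1 + 1).
  by exists (s / (S1 + 1)); rewrite ?divr_ge0 ?(ltW S11)// divfK// gt_eqF.
have H : 2 * u * s <= S2 + u ^+ 2 * S1.
  rewrite -S1E -rsumZ ?exprn_ge0//; last by move=> q; exact: normc_ge0.
  rewrite -rsumD//; [|by move=> q; rewrite mulr_ge0 ?exprn_ge0 ?normc_ge0
   |by apply: finsumZ => // [|q]; rewrite ?exprn_ge0 ?normc_ge0].
  have -> : 2 * u * s = normc ((2 * u)%:C * ncmul a b p).
    by rewrite normcM normc_real ger0_norm// mulr_ge0.
  have la : H0 a by apply/H0E.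
  rewrite -usumZ; last by apply: l1_conv => //; exact: H0_l1.
  apply: usum_norm.
    move=> q.
    rewrite !normcM normc_phase mul1r normc_real ger0_norm ?mulr_ge0//.
    rewrite /f/=; set A := normc (a q); set B := normc (b _).
    have B0 : 0 <= B by exact: normc_ge0.
    have := mulr_ge0 B0 (sqr_ge0 (A - u)); nra.
  apply: finsumD => //.
    by move=> q; rewrite mulr_ge0 ?exprn_ge0 ?normc_ge0.
  by apply: finsumZ => // [|q]; rewrite ?exprn_ge0 ?normc_ge0.
rewrite us in H *.
have : u ^+ 2 * (S1 + 1) <= S2 by nra.
by nra.
Qed.

(** Both sides are iterated sums of one double family, dominated by
    |c| (|a|^2 + |b|^2), so Fubini applies as soon as one factor is summable and
    the other two are square-summable.  The phases agree because phase is a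
    bicharacter, hence a cocycle. *)
Lemma ncmulA a b c : H0 a -> H0 b -> l1 c ->
  ncmul (ncmul a b) c = ncmul a (ncmul b c).
Proof.
move=> ha hb lc; apply/funext => p.
have hc := H0_l1 lc.
have /H0E fa := ha; have /H0E fb := hb.
pose F (u : Z2 * Z2) : C :=
  phase (u.1.2 * (p.1 - u.1.1)) *
  (phase (u.2.2 * (u.1.1 - u.2.1)) * (a u.2 * b (u.1 - u.2)) * c (p - u.1)).
have lF : l1 F.
  apply: l1_phase.
  apply: (@finsum_le _ _ _ (fun u : Z2 * Z2 =>
     normc (c (p - u.1)) * normc (a u.2) ^+ 2 +
     normc (c (p - u.1)) * normc (b (u.1 - u.2)) ^+ 2)).
    move=> u; rewrite !normcM normc_phase mul1r -mulrDr [leLHS]mulrC.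
    rewrite ler_wpM2l ?normc_ge0//; set A := normc _; set B := normc _.
    by have := sqr_ge0 (A - B); have := sqr_ge0 (A + B); nra.
  have lcp : finsum (fun q => normc (c (p - q))).
    exact: (finsum_reindex (f := fun q => normc (c q)) (subl_bij p)).
  apply: finsumD.
  - by move=> u; rewrite mulr_ge0 ?exprn_ge0 ?normc_ge0.
  - by move=> u; rewrite mulr_ge0 ?exprn_ge0 ?normc_ge0.
  - apply: (@finsum_prod _ _ _ (fun q => normc (c (p - q)))
      (fun q => normc (a q) ^+ 2) (fun _ q => q)) => //.
    + by move=> _; exists id.
    + by move=> q; exact: normc_ge0.
    + by move=> q; rewrite exprn_ge0 ?normc_ge0.
  - apply: (@finsum_prod _ _ _ (fun q => normc (c (p - q)))
      (fun q => normc (b q) ^+ 2) (fun r q => r - q)) => //.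
    + by move=> r; exact: subl_bij.
    + by move=> q; exact: normc_ge0.
    + by move=> q; rewrite exprn_ge0 ?normc_ge0.
transitivity (usum (fun r => usum (fun q => F (r, q)))).
  rewrite /Defs.ncmul; congr usum; apply/funext => r.
  rewrite mulrA mulrAC -usumZ; last exact: l1_conv.
  by congr usum; apply/funext => q; rewrite /F/=; ring.
rewrite usum_swap// /Defs.ncmul; congr usum; apply/funext => q.
rewrite mulrA -usumZ; last exact: l1_conv.
rewrite -(usum_reindex (addl_bij q) (l1_slice q (l1_swap lF))).
congr usum; apply/funext => s; rewrite /F/=.
rewrite [q + s - q](_ : _ = s); last by rewrite addrC addrA addNr add0r.
rewrite [c (p - (q + s))](_ : _ = c (p - q - s)); last by rewrite opprD addrA.
set A := a q; set B := b s; set D := c _.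
move: A B D; clear F lF; case: p q s => [p1 p2] [q1 q2] [s1 s2] A B D /=.
transitivity (phase ((q2 + s2) * (p1 - (q1 + s1)) + q2 * (q1 + s1 - q1))
  * (A * B * D)).
  by rewrite phaseD; ring.
transitivity (phase (q2 * (p1 - q1) + s2 * (p1 - q1 - s1)) * (A * B * D));
  last first.
  by rewrite phaseD; ring.
by congr (phase _ * _); ring.
Qed.

End Mul.
End L2.

(** * Rapidly decreasing series are summable *)

Section Smooth.
Variable R : realType.
Local Notation C := R[i].
Local Notation Z2 := (int * int)%type.

(** Telescoping: 1 / (n + 1)^2 <= 2 / (n + 1) - 2 / (n + 2). *)
Lemma finsum_invsq : finsum (fun n : nat => (n.+1%:R : R) ^- 2).
Proof.
have le2 N : \sum_(0 <= n < N) (n.+1%:R : R) ^- 2 <= 2 - 2 / N.+1%:R.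
  elim: N => [|N IH]; first by rewrite big_nil divr1 subrr.
  rewrite big_nat_recr//= (le_trans (lerD IH (lexx _)))//.
  have x0 : 0 < (N.+1%:R : R) by rewrite ltr0n.
  rewrite -(natr1 N.+1); set x := N.+1%:R in x0 *.
  have x1 : 1 <= x by rewrite /x ler1n.
  have x20 : 0 < x + 1 by rewrite addr_gt0.
  rewrite -subr_ge0.
  have -> : 2 - 2 / (x + 1) - (2 - 2 / x + x ^- 2) =
      (x - 1) / (x ^+ 2 * (x + 1)).
    by field; rewrite !gt_eqF.
  by apply: divr_ge0; rewrite ?subr_ge0// ltW// mulr_gt0// exprn_gt0.
rewrite /finsum -nneseries_esumT; last first.
  by move=> n; rewrite lee_fin invr_ge0 exprn_ge0.
apply: (@le_lt_trans _ _ 2%:E); last exact: ltry.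
apply: lime_le.
  by apply: is_cvg_nneseries => n _ _; rewrite lee_fin invr_ge0 exprn_ge0.
apply: nearW => N; rewrite sumEFin lee_fin (le_trans (le2 N))//.
by rewrite gerBl divr_ge0.
Qed.

Lemma finsum_int : finsum (fun m : int => ((1 + `|m|)%:~R : R) ^- 2).
Proof.
pose e (u : bool * nat) := if u.1 then Posz u.2 else Negz u.2.
pose e' (m : int) :=
  match m with Posz n => (true, n) | Negz n => (false, n) end.
have be : bijective e' by exists e => [[]|[[] n]].
pose f (u : bool * nat) : R := 1 * u.2.+1%:R ^- 2.
have f0 (n : nat) : 0 <= (n.+1%:R : R) ^- 2 by rewrite invr_ge0 exprn_ge0.
have ff : finsum f.
  apply: (@finsum_prod _ _ _ (fun _ : bool => 1) (fun n : nat => n.+1%:R ^- 2)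
    (fun _ n => n)) => //.
  - by move=> _; exists id.
  - rewrite /finsum esum_fset//; last exact: finite_finset.
    by rewrite fsbig_finite ?sumEFin ?ltry//; exact: finite_finset.
  - exact: finsum_invsq.
apply: finsum_le (finsum_reindex be ff) => -[n|n]; rewrite /f/= mul1r.
  by rewrite lef_pV2 ?posrE ?exprn_gt0 ?ltr0n ?ltr0z//
    ler_pXn2r ?nnegrE ?ler0n ?ler0z// -[n.+1%:R]/(n.+1%:~R) ler_int.
rewrite lef_pV2 ?posrE ?exprn_gt0 ?ltr0n ?ltr0z//
  ler_pXn2r ?nnegrE ?ler0n ?ler0z//.
rewrite -[n.+1%:R]/(n.+1%:~R) ler_int; lia.
Qed.

(** Decay of order 4 is enough:
    (1 + |m| + |n|)^2 >= (1 + |m|) (1 + |n|), and the inverse squares of the two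
    factors are summable over the integers. *)
Lemma smooth_l1 (a : series2 R) : smooth a -> l1 a.
Proof.
move=> /(_ 4%N)[M aM].
pose g (m : int) : R := (1 + `|m|)%:~R.
have g1 m : 1 <= g m by rewrite ler1z; lia.
have g0 m : 0 < g m by rewrite (lt_le_trans ltr01).
have fg : finsum (fun p : Z2 => complex.Re M * (g p.1 ^- 2 * g p.2 ^- 2)).
  have M0 : 0 <= complex.Re M.
    have := aM 0 0; rewrite lecE => /andP[_]; apply: le_trans.
    by rewrite addr0 addr0 expr1n mul1r normE normc_ge0.
  apply: finsumZ => //.
    by move=> p; rewrite mulr_ge0// invr_ge0 exprn_ge0// ltW.
  apply: (@finsum_prod _ _ _ (fun m => g m ^- 2) (fun m => g m ^- 2)
    (fun _ m => m)).
  - by move=> _; exists id.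
  - by move=> m; rewrite invr_ge0 exprn_ge0// ltW.
  - by move=> m; rewrite invr_ge0 exprn_ge0// ltW.
  - exact: finsum_int.
  - exact: finsum_int.
apply: finsum_le fg => -[m n] /=.
have := aM m n; set s := (1 + _ + _).
have -> : s%:~R ^+ 4 * `|a (m, n)| = (s%:~R ^+ 4 * normc (a (m, n)))%:C.
  by rewrite normE rmorphM rmorphXn/= rmorph_int.
rewrite lecE => /andP[_]/= h.
rewrite -invfM ler_pdivlMr; last by rewrite mulr_gt0// exprn_gt0.
apply: le_trans h; rewrite mulrC ler_wpM2r ?normc_ge0// -exprMn.
have s0 : 0 <= (s%:~R : R) by rewrite ler0z /s; lia.
have gs : g m * g n <= s%:~R ^+ 2 by rewrite expr2 /g -!intrM ler_int /s; nia.
rewrite -[4%N]/(2 * 2)%N exprM ler_pXn2r// nnegrE ?exprn_ge0//.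
by rewrite mulr_ge0// ltW.
Qed.

End Smooth.

(** * Inner product, involution and positivity *)

Section IP.
Variable R : realType.
Local Notation C := R[i].
Local Notation Z2 := (int * int)%type.
Variable theta : R.
Implicit Types x y z a b c : series2 R.
Local Notation ncmul := (ncmul theta).
Local Notation star := (star theta).
Local Notation phase := (phase theta).
Local Notation ip := (ip theta).
Local Notation monomial := (@monomial R).

Lemma l1_monomial p : l1 (monomial p).
Proof. by apply: (@l1_single _ _ _ p) => q /negPf qp; rewrite /monomial qp. Qed.

Lemma H0_monomial p : H0 (monomial p).
Proof. exact/H0_l1/l1_monomial. Qed.

Lemma l1_ip x y : H0 x -> H0 y -> l1 (fun p => x p * (y p)^*).
Proof.
move=> hx hy; apply: l1_mul => //.
by apply: (H0_le ler01) hy => p; rewrite normc_conj mul1r.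
Qed.

Lemma ipDl d x y z : H0 x -> H0 y -> H0 z ->
  ip (d *: x + y) z = d * ip x z + ip y z.
Proof.
move=> hx hy hz; rewrite !ip_sum//; last by apply: H0D => //; exact: H0Z.
rewrite -usum_lin; [|exact: l1_ip..].
by congr usum; apply/funext => p;
  rewrite [(_ + _) p](_ : _ = d * x p + y p)//; ring.
Qed.

Lemma ipC x y : H0 x -> H0 y -> ip x y = (ip y x)^*.
Proof.
move=> hx hy; rewrite !ip_sum// -usumJ; last exact: l1_ip.
by congr usum; apply/funext => p; rewrite rmorphM/= conjCK mulrC.
Qed.

Lemma ipDr d z x y : H0 z -> H0 x -> H0 y ->
  ip z (d *: x + y) = d^* * ip z x + ip z y.
Proof.
move=> hz hx hy; rewrite (ipC hz); last by apply: H0D => //; exact: H0Z.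
by rewrite ipDl// rmorphD rmorphM/= -(ipC hz hx) -(ipC hz hy).
Qed.

Lemma ipZl d x z : H0 x -> H0 z -> ip (d *: x) z = d * ip x z.
Proof.
move=> hx hz; rewrite !ip_sum//; last exact: H0Z.
rewrite -usumZ; last exact: l1_ip.
by congr usum; apply/funext => p; rewrite [(_ *: _) p](_ : _ = d * x p)// mulrA.
Qed.

Lemma ipZr d x z : H0 x -> H0 z -> ip x (d *: z) = d^* * ip x z.
Proof.
move=> hx hz; rewrite ipC//; last exact: H0Z.
by rewrite ipZl// rmorphM/= -ipC.
Qed.

Lemma ip_monomial x p : H0 x -> ip x (monomial p) = x p.
Proof.
move=> hx; rewrite ip_sum//; last exact: H0_monomial.
rewrite (@usum_single _ _ _ p); first by rewrite /monomial eqxx rmorph1 mulr1.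
by move=> q /negPf qp; rewrite /monomial qp rmorph0 mulr0.
Qed.

Lemma ip_ge0 x : H0 x -> exists2 r : R, 0 <= r & ip x x = r%:C.
Proof.
move=> hx; exists (rsum (fun p => normc (x p) ^+ 2)).
  by apply: rsum_ge0 => p; rewrite exprn_ge0// normc_ge0.
have /H0E fx := hx; rewrite ip_sum//.
have -> : (fun p => x p * (x p)^*) = (fun p => (normc (x p) ^+ 2)%:C).
  by apply/funext => p; rewrite mulCJ.
by apply: usum_real fx => p; rewrite exprn_ge0// normc_ge0.
Qed.

Lemma ip_eq0 x : H0 x -> ip x x = 0 -> x = 0.
Proof.
move=> hx; rewrite ip_sum//.
have x0 p : 0 <= normc (x p) ^+ 2 by rewrite exprn_ge0// normc_ge0.
have /H0E fx := hx.
have -> : (fun p => x p * (x p)^*) = (fun p => (normc (x p) ^+ 2)%:C).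
  by apply/funext => p; rewrite mulCJ.
rewrite usum_real// => -[] /(rsum_eq0 x0 fx) h.
apply/funext => p; have /eqP := h p; rewrite expf_eq0/= => /eqP.
exact: eq0_normc.
Qed.

Lemma ip_star x y : H0 x -> H0 y -> ip (star x) (star y) = (ip x y)^*.
Proof.
move=> hx hy; rewrite !ip_sum//; [|exact: H0_star..].
rewrite -(usum_reindex opp_bij (l1_ip hx hy)) -usumJ; last first.
  exact: (l1_reindex opp_bij (l1_ip hx hy)).
congr usum; apply/funext => p; rewrite /Defs.star !rmorphM/= conjCK.
by rewrite mulrACA mulCJ normc_phase expr1n mul1r.
Qed.

Lemma H0_starK x : H0 (star x) -> H0 x.
Proof. by move=> /(@H0_star _ theta); rewrite starK. Qed.

(** The involution exchanges left and right multiplication. *)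
Lemma H0_ncmull a x : l1 a -> H0 x -> H0 (ncmul a x).
Proof.
move=> la hx; apply: H0_starK; rewrite star_ncmul//; last exact: H0_l1.
by apply: H0_ncmul; [exact: H0_star|exact: l1_star].
Qed.

Lemma ncmulDr a d x y : H0 a -> H0 x -> H0 y ->
  ncmul a (d *: x + y) = d *: ncmul a x + ncmul a y.
Proof.
move=> ha hx hy; apply: (can_inj (starK theta)).
have hs := @H0_star R theta; have hxy : H0 (d *: x + y) by apply/H0D/hy/H0Z.
by rewrite star_ncmul// !starDl ncmulDl//; do ?exact: hs; rewrite -!star_ncmul.
Qed.

Lemma ncmul_monomial a p q :
  ncmul a (monomial p) q = phase ((q - p).2 * p.1) * a (q - p).
Proof.
rewrite /Defs.ncmul (@usum_single _ _ _ (q - p)).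
  have E : q - (q - p) = p by rewrite opprB addrC subrK.
  by rewrite -[q.1 - (q - p).1]/((q - (q - p)).1) E /monomial eqxx mulr1.
move=> r /eqP rqp; rewrite /monomial; case: eqP => [qr|_];
  last by rewrite !mulr0.
by case: rqp; rewrite -qr opprB addrC subrK.
Qed.

Lemma ncmul1 a : ncmul a (@ncone R) = a.
Proof.
by apply/funext => p; rewrite ncmul_monomial subr0 mulr0 phase0 mul1r.
Qed.

Lemma mul1nc a : ncmul (@ncone R) a = a.
Proof.
apply/funext => p; rewrite /Defs.ncmul (@usum_single _ _ _ 0).
  by rewrite mul0r phase0 !mul1r subr0.
by move=> q /negPf q0; rewrite /ncone q0 mul0r mulr0.
Qed.

Lemma star1 : star (@ncone R) = @ncone R.
Proof.
apply/funext => p; rewrite /Defs.star /ncone oppr_eq0.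
by have [->|] := eqVneq p 0; rewrite ?mulr0 ?phase0 ?rmorph1 ?mulr1//
  rmorph0 mulr0.
Qed.

(** Polarization on the pairs of monomials U^m V^n and 1: the form of a positive
    operator takes real values on the diagonal, hence is hermitian, and its
    entries against 1 are the coefficients of k and of its adjoint. *)
Lemma positive_star k : l1 k -> positive theta k -> star k = k.
Proof.
move=> lk hpos.
have hk := H0_l1 lk.
pose B x y := ip (ncmul k x) y.
have BE p : B (monomial p) (monomial 0) = (B (monomial 0) (monomial p))^*.
  have hp q : H0 (ncmul k (monomial q)).
    by apply: H0_ncmull => //; exact: H0_monomial.
  have real x : H0 x -> complex.Im (B x x) = 0 by move=> /hpos; exact: ger0_Im.
  have ex d : B (d *: monomial p + monomial 0) (d *: monomial p + monomial 0) =
      d * d^* * B (monomial p) (monomial p) + B (monomial 0) (monomial 0) +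
      (d * B (monomial p) (monomial 0) + d^* * B (monomial 0) (monomial p)).
    have hd : H0 (d *: monomial p + monomial 0)
      by apply/H0D/H0_monomial/H0Z/H0_monomial.
    rewrite /B ncmulDr//; [|exact: H0_monomial..].
    rewrite ipDl// (ipDr d (hp p) (H0_monomial p) (H0_monomial 0))
      (ipDr d (hp 0) (H0_monomial p) (H0_monomial 0)).
    by set b1 := ip _ _; set b2 := ip _ _; set b3 := ip _ _; set b4 := ip _ _;
      ring.
  have hd d : H0 (d *: monomial p + monomial 0)
    by apply/H0D/H0_monomial/H0Z/H0_monomial.
  have r1 := real _ (hd 1); have ri := real _ (hd 'i).
  have rp := real _ (H0_monomial p); have r0 := real _ (H0_monomial 0).
  move: r1 ri; rewrite !ex; move: rp r0.
  case: (B (monomial p) (monomial p)) => a1 a2;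
    case: (B (monomial 0) (monomial 0)) => b1 b2.
  case: (B (monomial p) (monomial 0)) => c1 c2;
    case: (B (monomial 0) (monomial p)) => d1 d2 /=.
  move=> -> -> h1 h2.
  congr Complex; lra.
apply/funext => p; have := BE (- p).
rewrite /B !ip_monomial; do ?by apply: H0_ncmull => //; exact: H0_monomial.
rewrite !ncmul_monomial sub0r opprK subr0 mulr0 phase0 mul1r.
move=> h; rewrite /Defs.star -h mulrA -phaseD.
by rewrite (_ : _ + _ = 0) ?phase0 ?mul1r//; case: p {h} => p1 p2 /=; ring.
Qed.

Lemma inverse_star k kinv : l1 k -> l1 kinv -> star k = k ->
  ncmul k kinv = @ncone R -> star kinv = kinv.
Proof.
move=> lk lki sk kki.
have h : ncmul (star kinv) k = @ncone R.
  by rewrite -{1}sk -star_ncmul ?kki ?star1//; exact: H0_l1.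
rewrite -[LHS]ncmul1 -kki -ncmulA ?h ?mul1nc//; last exact: H0_l1.
exact/H0_star/H0_l1.
Qed.

(** The product of two square-summable series need not be square-summable, but
    its coefficients are bounded. *)
Lemma ncmul_bounded a b : H0 a -> H0 b ->
  exists2 M : R, 0 <= M & forall p, normc (ncmul a b p) <= M.
Proof.
move=> /[dup] ha /H0E fa /[dup] hb /H0E fb.
have sq0 x p : 0 <= normc (x p) ^+ 2 by rewrite exprn_ge0// normc_ge0.
pose A := rsum (fun q => normc (a q) ^+ 2).
pose B := rsum (fun q => normc (b q) ^+ 2).
exists (A + B); first by rewrite addr_ge0// rsum_ge0.
move=> p.
have fb' : finsum (fun q : Z2 => normc (b (p - q)) ^+ 2).
  exact: (finsum_reindex (f := fun q => normc (b q) ^+ 2) (subl_bij p)).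
have -> : A + B =
    rsum (fun q : Z2 => normc (a q) ^+ 2 + normc (b (p - q)) ^+ 2).
  rewrite rsumD//; congr (_ + _).
  by rewrite (rsum_reindex (fun q => normc (b q) ^+ 2) (subl_bij p)).
apply: usum_norm; last exact: finsumD.
move=> q; rewrite !normcM normc_phase mul1r.
set s := normc _; set t := normc _.
by have := sqr_ge0 (s - t); have := sqr_ge0 (s + t); nra.
Qed.

Lemma l1_bounded (m c : series2 R) (M : R) :
  0 <= M -> (forall p, normc (m p) <= M) -> l1 c -> l1 (fun p => m p * c p).
Proof.
move=> M0 mM lc; apply: (@finsum_le _ _ _ (fun p => M * normc (c p))).
  by move=> p; rewrite normcM ler_wpM2r ?normc_ge0.
by apply: finsumZ => // p; exact: normc_ge0.
Qed.

(** By associativity the two sides are tau0 (m c) and the conjugate of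
    tau0 (m^* c^* ), where m = v^* u.  As m is only bounded, [star_ncmul] does
    not apply to m c, and the two sums are compared term by term. *)
Lemma ip_ncmulr u v c : H0 u -> H0 v -> l1 c ->
  ip (ncmul u c) v = ip u (ncmul v (star c)).
Proof.
move=> hu hv lc; have hc := H0_l1 lc.
have hs := @H0_star R theta.
pose m := ncmul (star v) u.
have ms : star m = ncmul (star u) v by rewrite star_ncmul ?starK//; exact: hs.
rewrite [RHS]ipC//; last by apply: H0_ncmul => //; exact: l1_star.
rewrite /Defs.ip -(ncmulA theta (hs _ hv) hu lc).
rewrite -(ncmulA theta (hs _ hu) hv (l1_star theta lc))
  -ms -/m /tau0 /Defs.ncmul.
have lm : l1 (fun q : Z2 => phase (q.2 * (0 - q.1)) * (m q * c (0 - q))).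
  apply: l1_phase; have [M M0 mM] := ncmul_bounded (hs _ hv) hu.
  apply: (l1_bounded M0 mM).
  exact: (l1_reindex (subl_bij 0) lc).
have ln : l1 (fun q : Z2 => phase (q.2 * (0 - q.1))
  * (star m q * star c (0 - q))).
  apply: l1_phase; have [M M0 mM] := ncmul_bounded (hs _ hu) hv.
  rewrite -ms in mM; apply: (l1_bounded M0 mM).
  exact: (l1_reindex (subl_bij 0) (l1_star theta lc)).
rewrite -usumJ// -(usum_reindex opp_bij lm).
congr usum; apply/funext => q.
rewrite /Defs.star !rmorphM/= !conjCK !sub0r !opprK.
case: q => q1 q2 /=; set A := m _; set B := c _.
rewrite -!phaseN.
transitivity (phase (- (q2 * - q1) - q1 * q2 - (- q1) * (- q2)) * (A * B));
  last first.
  by rewrite !phaseD; ring.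
by congr (phase _ * _); ring.
Qed.

End IP.

(** * Constant-coefficient first-order operators *)

Section Multipliers.
Variable R : realType.
Local Notation C := R[i].
Local Notation Z2 := (int * int)%type.
Implicit Types (x y z : series2 R) (sigma c : C).

(** In the basis of the monomials U^m V^n, delta1 + sigma delta2 + c is the
    multiplication by m + sigma n + c. *)
Definition symbol sigma c (p : Z2) : C := p.1%:~R + sigma * p.2%:~R + c.

Definition mulop sigma c x : series2 R := fun p => symbol sigma c p * x p.

Lemma dolbeaultE sigma c x y :
  dolbeault sigma c (x, y) <-> H1 x /\ y = mulop sigma c x.
Proof.
rewrite /dolbeault/=.
suff -> : delta1 x + sigma *: delta2 x + c *: x = mulop sigma c x by [].
apply/funext => p; rewrite /mulop /symbol !mulrDl -mulrA.
by [].
Qed.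

Lemma intC (m : int) : (m%:~R : C) = (m%:~R)%:C.
Proof. by rewrite rmorph_int. Qed.

Lemma normc_int (m : int) : normc (m%:~R : C) = `|m%:~R : R|.
Proof. by rewrite intC normc_real. Qed.

Lemma symbolE sigma c (p : Z2) : symbol sigma c p =
  Complex (p.1%:~R + complex.Re sigma * p.2%:~R + complex.Re c)
          (complex.Im sigma * p.2%:~R + complex.Im c).
Proof.
rewrite /symbol !intC; case: sigma c => [s1 s2] [c1 c2].
by simpc; rewrite /= ?(mulr0, addr0, add0r, subr0).
Qed.

Lemma symbol_conj sigma c p : (symbol sigma c p)^* = symbol sigma^* c^* p.
Proof. by rewrite /symbol !rmorphD rmorphM/= !rmorph_int. Qed.

Lemma symbol_conjN sigma c p :
  (symbol sigma c (- p))^* = - symbol sigma^* (- c^*) p.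
Proof. by rewrite symbol_conj /symbol/= !mulrNz; ring. Qed.

(** Ellipticity: as sigma is not real, the imaginary part of the symbol controls
    n, and then its real part controls m. *)
Lemma symbol_elliptic sigma c : complex.Im sigma != 0 ->
  exists2 K : R, 0 <= K & forall p : Z2,
    `|p.1%:~R| <= K * (normc (symbol sigma c p) + 1) /\
    `|p.2%:~R| <= K * (normc (symbol sigma c p) + 1).
Proof.
move=> s0; set s := complex.Im sigma in s0.
have s1 : 0 < `|s| by rewrite normr_gt0.
pose K2 := (1 + `|complex.Im c|) / `|s|.
have K20 : 0 <= K2 by rewrite divr_ge0// addr_ge0.
pose K1 := 1 + `|complex.Re sigma| * K2 + `|complex.Re c|.
have K10 : 0 <= K1 by rewrite !addr_ge0// mulr_ge0.
exists (K1 + K2); first by rewrite addr_ge0.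
move=> p; set n := normc _; have n0 : 0 <= n by exact: normc_ge0.
have hI := normr_Im (symbol sigma c p); have hR := normr_Re (symbol sigma c p).
rewrite -/n symbolE/= -/s in hI; rewrite -/n symbolE/= in hR.
set a := p.1%:~R in hR *; set b := p.2%:~R in hR hI *.
have b1 : `|b| <= K2 * (n + 1).
  rewrite mulrAC ler_pdivlMr// mulrC -normrM.
  have := ler_normB (s * b + complex.Im c) (complex.Im c); rewrite addrK => h.
  have := normr_ge0 (complex.Im c); nra.
have a1 : `|a| <= K1 * (n + 1).
  have := ler_normB (a + complex.Re sigma * b + complex.Re c)
    (complex.Re sigma * b + complex.Re c).
  rewrite (_ : _ - _ = a) => [h|]; last by ring.
  have h2 := ler_normD (complex.Re sigma * b) (complex.Re c).
  rewrite normrM in h2.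
  have h3 : `|complex.Re sigma| * `|b| <= `|complex.Re sigma| * (K2 * (n + 1)).
    by rewrite ler_wpM2l.
  have h4 : 0 <= `|complex.Re c| * n by rewrite mulr_ge0.
  have -> : K1 * (n + 1) = n + 1 + `|complex.Re sigma| * (K2 * (n + 1)) +
      `|complex.Re c| * n + `|complex.Re c| by rewrite /K1; ring.
  by lra.
have n1 : 0 <= n + 1 by rewrite addr_ge0.
have k1 := mulr_ge0 K10 n1; have k2 := mulr_ge0 K20 n1.
by split; lra.
Qed.

Lemma finite_lower_bound (f : Z2 -> R) (s : seq Z2) : (forall p, 0 <= f p) ->
  exists2 d : R, 0 < d & forall p, p \in s -> f p != 0 -> d <= f p.
Proof.
move=> f0; elim: s => [|p s [d d0 IH]]; first by exists 1.
have [fp|fp] := eqVneq (f p) 0.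
  by exists d => // q; rewrite inE => /orP[/eqP->|/IH//]; rewrite fp eqxx.
exists (Num.min d (f p)); first by rewrite lt_min d0 lt_neqAle eq_sym fp f0.
move=> q; rewrite inE ge_min => /orP[/eqP-> _|/IH h /h ->//].
by rewrite lexx orbT.
Qed.

(** By ellipticity the symbol has modulus less than 1 only on a finite set, so
    its nonzero values stay away from 0. *)
Lemma symbol_lower_bound sigma c : complex.Im sigma != 0 ->
  exists2 d : R, 0 < d & forall p : Z2, symbol sigma c p != 0 ->
    d <= normc (symbol sigma c p).
Proof.
move=> s0; have [K K0 hK] := symbol_elliptic c s0.
pose N := Num.bound (K * 2).
have hN : K * 2 < N%:R by apply: archi_boundP; rewrite mulr_ge0.
pose r : seq int := [seq i%:Z - N%:Z | i : nat <- iota 0 (2 * N).+1].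
have [d d0 hd] := @finite_lower_bound (fun p => normc (symbol sigma c p))
   [seq (a, b) | a <- r, b <- r] (fun=> normc_ge0 _).
exists (Num.min d 1); first by rewrite lt_min d0/=.
move=> p p0; have [//|lt1] := leP 1 (normc (symbol sigma c p)).
  by rewrite ge_min orbC => ->.
rewrite ge_min hd//; last by apply: contra_neq p0; exact: eq0_normc.
have inr (m : int) : `|m%:~R| <= K * (normc (symbol sigma c p) + 1) -> m \in r.
  move=> h; have : `|m%:~R| < (N%:R : R).
    apply: le_lt_trans h (le_lt_trans _ hN); rewrite ler_wpM2l//.
    by rewrite -lerBrDr (le_trans (ltW lt1))//; lra.
  rewrite -intr_norm -[N%:R]/(N%:~R) ltr_int => mN.
  apply/mapP; exists (absz (m + N%:Z)); first by rewrite mem_iota; lia.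
  lia.
have [h1 h2] := hK p; rewrite [p]surjective_pairing.
by apply/allpairsP; exists p; split => //; exact: inr.
Qed.

Lemma H0_norm x y : (forall p, normc (x p) = normc (y p)) -> H0 x -> H0 y.
Proof. by move=> xy; apply: (H0_le ler01) => p; rewrite mul1r xy. Qed.

Lemma H1_norm x y : (forall p, normc (x p) = normc (y p)) -> H1 x -> H1 y.
Proof.
move=> xy [h0 h1 h2]; split; first exact: H0_norm h0.
- by apply: H0_norm h1 => p; rewrite !normcM xy.
- by apply: H0_norm h2 => p; rewrite !normcM xy.
Qed.

Lemma H1_mulop sigma c x : H1 x -> H0 (mulop sigma c x).
Proof.
move=> [h0 h1 h2].
suff -> : mulop sigma c x = delta1 x + sigma *: delta2 x + c *: x.
  by apply: H0D; [apply: H0D => //; exact: H0Z|exact: H0Z].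
by apply/funext => p; rewrite /mulop /symbol !mulrDl -mulrA.
Qed.

(** Elliptic regularity. *)
Lemma mulop_H1 sigma c x : complex.Im sigma != 0 ->
  H0 x -> H0 (mulop sigma c x) -> H1 x.
Proof.
move=> s0 h0 h1; have [K K0 hK] := symbol_elliptic c s0.
pose g : series2 R :=
  (fun p => (normc (mulop sigma c x p))%:C) + (fun p => (normc (x p))%:C).
have hg : H0 g.
  apply: H0D.
    by apply: H0_norm h1 => p; rewrite normc_real ger0_norm ?normc_ge0.
  by apply: H0_norm h0 => p; rewrite normc_real ger0_norm ?normc_ge0.
have gE p : normc (g p) = (normc (symbol sigma c p) + 1) * normc (x p).
  rewrite [g p](_ : _ = (normc (mulop sigma c x p) + normc (x p))%:C).
    by rewrite normc_real ger0_norm ?addr_ge0 ?normc_ge0// normcM mulrDl mul1r.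
  by rewrite rmorphD.
split => //; apply: (H0_le K0) hg => p; rewrite normcM normc_int gE mulrA;
  by rewrite ler_wpM2r ?normc_ge0//; case: (hK p).
Qed.

(** The range of the operator is closed: it consists of all the series that
    vanish at the zeros of the symbol. *)
Lemma H0_inv sigma c x : complex.Im sigma != 0 -> H0 x ->
  (forall p, symbol sigma c p = 0 -> x p = 0) ->
  exists2 y, H1 y & mulop sigma c y = x.
Proof.
move=> s0 hx x0; have [d d0 hd] := symbol_lower_bound c s0.
pose y : series2 R := fun p => (symbol sigma c p)^-1 * x p.
have yx : mulop sigma c y = x.
  apply/funext => p; rewrite /mulop /y.
  have [e|e] := eqVneq (symbol sigma c p) 0; first by rewrite e mul0r x0.
  by rewrite mulrA divff// mul1r.
exists y => //; apply: (@mulop_H1 sigma c) => //; last by rewrite yx.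
have d10 : 0 <= d^-1 by rewrite invr_ge0 ltW.
apply: (H0_le d10) hx => p; rewrite /y normcM normcV ler_wpM2r ?normc_ge0//.
have [e|e] := eqVneq (symbol sigma c p) 0; first by rewrite e normc0 invr0.
by rewrite lef_pV2 ?posrE ?hd// (lt_le_trans d0)// hd.
Qed.

Lemma mulopC sigma c sigma' c' x :
  mulop sigma c (mulop sigma' c' x) = mulop sigma' c' (mulop sigma c x).
Proof. by apply/funext => p; rewrite /mulop mulrCA. Qed.

Lemma mulopN sigma c x : mulop sigma c (- x) = - mulop sigma c x.
Proof. by apply/funext => p; rewrite /mulop mulrN. Qed.

Section Theta.
Variable theta : R.

Lemma H1_monomial p : H1 (@monomial R p).
Proof.
have s q (a : Z2 -> C) : q != p -> a q * monomial R p q = 0.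
  by move=> /negPf qp; rewrite /monomial qp mulr0.
split; first exact: H0_monomial; apply/H0_l1/(@l1_single _ _ _ p) => q qp.
  exact: (s _ (fun q => q.1%:~R)).
exact: (s _ (fun q => q.2%:~R)).
Qed.

Lemma H1_star x : H1 x -> H1 (star theta x).
Proof.
have bo := opp_bij.
move=> [h0 h1 h2]; split; first exact: H0_star.
- apply: H0_norm (H0_reindex bo h1) => p.
  rewrite /delta1 /star !normcM normc_phase mul1r normc_conj.
  by rewrite !normc_int/= mulrNz normrN.
- apply: H0_norm (H0_reindex bo h2) => p.
  rewrite /delta2 /star !normcM normc_phase mul1r normc_conj.
  by rewrite !normc_int/= mulrNz normrN.
Qed.

(** The involution reflects the index p into - p, whence the sign. *)
Lemma star_mulop sigma c x :
  star theta (mulop sigma c x) = - mulop sigma^* (- c^*) (star theta x).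
Proof.
apply/funext => p; rewrite /star /mulop rmorphM/= symbol_conjN.
by rewrite mulrCA mulNr.
Qed.

Lemma ip_mulop sigma c x z : H1 x -> H1 z ->
  ip theta (mulop sigma c x) z = ip theta x (mulop sigma^* c^* z).
Proof.
move=> hx hz; have [hx0 _ _] := hx; have [hz0 _ _] := hz.
rewrite !ip_sum//; [|exact: H1_mulop..].
congr usum; apply/funext => p; rewrite /mulop rmorphM/= -symbol_conj conjCK.
by rewrite mulrCA mulrA.
Qed.

End Theta.
End Multipliers.

(** * The Laplacians and their models *)

Section Operators.
Variable R : realType.
Local Notation C := R[i].
Local Notation Z2 := (int * int)%type.
Implicit Types (x y z : series2 R).
Variables (theta : R) (tau w : C) (k kinv : series2 R).
Hypothesis htau : 0 < complex.Im tau.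
Hypotheses (lk : l1 k) (lki : l1 kinv).
Hypotheses (sk : star theta k = k) (ski : star theta kinv = kinv).
Hypotheses (kki : ncmul theta k kinv = @ncone R)
  (kik : ncmul theta kinv k = @ncone R).
Local Notation ncmul := (ncmul theta).
Local Notation star := (star theta).
Local Notation ip := (ip theta).
Local Notation ipphi := (ip_phi theta kinv).
Local Notation kappa := (ncmul kinv kinv).
Local Notation k2 := (ncmul k k).

Let Im_tau : complex.Im tau != 0.
Proof. by rewrite gt_eqF. Qed.
Let Im_tauJ : complex.Im tau^* != 0.
Proof. by case: tau htau => a b /=; rewrite oppr_eq0 => /gt_eqF->. Qed.

Let hk : H0 k. Proof. exact: H0_l1. Qed.
Let hki : H0 kinv. Proof. exact: H0_l1. Qed.

Lemma l1_kappa : l1 kappa. Proof. exact: l1_ncmul. Qed.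

Lemma star_kappa : star kappa = kappa.
Proof. by rewrite star_ncmul ?ski. Qed.

Lemma ncmul_cancel a b x : l1 a -> l1 b -> ncmul a b = @ncone R -> H0 x ->
  ncmul (ncmul x a) b = x.
Proof. by move=> la lb ab hx; rewrite ncmulA ?ab ?ncmul1//; exact: H0_l1. Qed.

Lemma ip_phi_mull x y : H0 x -> H0 y -> ipphi x y = ip (ncmul x kappa) y.
Proof.
move=> hx hy; rewrite /ip_phi /Defs.ip ncmulA//; last exact: l1_kappa.
exact: H0_star.
Qed.

Lemma ip_phi_mulr x y : H0 x -> H0 y -> ipphi x y = ip x (ncmul y kappa).
Proof.
by move=> hx hy; rewrite ip_phi_mull// ip_ncmulr ?star_kappa//; exact: l1_kappa.
Qed.

Lemma ncmul_kappa x : H0 x -> ncmul x kappa = ncmul (ncmul x kinv) kinv.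
Proof. by move=> hx; rewrite ncmulA. Qed.

(** Right multiplications by kinv^2 and by k^2 are inverse to each other. *)
Lemma ncmul_kappaP x y : H0 x -> H0 y ->
  ncmul y kappa = x <-> y = ncmul x k2.
Proof.
move=> hx hy; rewrite ncmul_kappa// -ncmulA//; split => [<-|->].
  by rewrite (ncmul_cancel lki lk)// ?(ncmul_cancel lki lk)//; exact: H0_ncmul.
by rewrite (ncmul_cancel lk lki)// ?(ncmul_cancel lk lki)//; exact: H0_ncmul.
Qed.

Lemma nablaE x y : nabla tau w (x, y) <-> H1 x /\ y = mulop tau^* w x.
Proof. exact: dolbeaultE. Qed.

(** Testing the adjunction on the monomials determines every coefficient, and
    elliptic regularity then puts z in the domain.  With [ncmul_kappaP], the
    adjoint of nabla is del^* + conj w followed by right multiplication by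
    k^2. *)
Lemma nabla_adjE z y : nabla_adj theta tau w kinv (z, y) <->
  [/\ H1 z, H0 y & mulop tau w^* z = ncmul y kappa].
Proof.
split=> [[/= hz hy adj]|[hz hy e]].
  have hyk : H0 (ncmul y kappa) by apply: H0_ncmul => //; exact: l1_kappa.
  have e : mulop tau w^* z = ncmul y kappa.
    apply/funext => p.
    have := adj (_, _) (iffRL (nablaE _ _) (conj (H1_monomial R p) erefl)).
    rewrite /= ip_phi_mulr//; last exact: H0_monomial.
    rewrite [RHS]ipC//; last exact: H0_monomial.
    rewrite ip_monomial// ipC//; last by apply: H1_mulop; exact: H1_monomial.
    move=> /(can_inj conjCK) <-.
    have -> : mulop tau^* w (monomial R p) = symbol tau^* w p *: monomial R p.
      apply/funext => q.
      rewrite /mulop [RHS](_ : _ = symbol tau^* w p * monomial R p q)//.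
      by rewrite /monomial; case: eqP => [->//|_]; rewrite !mulr0.
    by rewrite ipZr ?ip_monomial//;
      [rewrite symbol_conj conjCK|exact: H0_monomial].
  by split => //; apply: (@mulop_H1 _ tau w^*) => //; rewrite e.
have [hz0 _ _] := hz.
split => //= -[x x'] /nablaE[hx ->] /=; have [hx0 _ _] := hx.
by rewrite ip_phi_mulr// -e ip_mulop// conjCK.
Qed.

(** Right multiplication by kinv is unitary from H_phi onto H0, as phi has
    density k^-2.  The involution that follows is antiunitary and turns the
    right multiplications by k in Delta0 into left multiplications. *)
Definition right_twist x := star (ncmul x kinv).

Lemma H0_right_twist x : H0 x -> H0 (right_twist x).
Proof. by move=> hx; apply/H0_star/H0_ncmul. Qed.

Lemma ncmul_right_twist x : H0 x -> ncmul k (right_twist x) = star x.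
Proof.
move=> hx; rewrite /right_twist -{1}sk -star_ncmul//; last exact: H0_ncmul.
by rewrite (ncmul_cancel lki lk).
Qed.

(** The involution turns del + w into - (del^* - conj w).  It produces the two
    first-order factors of model0 in the opposite order; being multipliers they
    commute, and their symbols are conjugate up to sign, hence of equal modulus,
    so that the two compositions have the same domain as well. *)
Lemma Delta0_model0 x y : H0 x -> H0 y ->
  Delta0 theta tau w kinv (x, y) <->
  model0 theta tau w k (right_twist x, right_twist y).
Proof.
move=> hx hy.
have sx : mulop tau (- w^*) (star x) = - star (mulop tau^* w x).
  by rewrite star_mulop conjCK opprK.
have comm : mulop tau (- w^*) (mulop tau^* (- w) (star x)) =
    star (mulop tau w^* (mulop tau^* w x)).
  by rewrite mulopC sx mulopN [RHS]star_mulop conjCK.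
have nrm p : normc (mulop tau^* (- w) (star x) p) =
    normc (star (mulop tau^* w x) p).
  have -> : star (mulop tau^* w x) p = - mulop tau (- w^*) (star x) p.
    by rewrite sx opprK.
  by rewrite normcN !normcM -[in LHS]normc_conj symbol_conj conjCK rmorphN.
have yP v : H0 v -> right_twist y = ncmul k (star v) <-> v = ncmul y kappa.
  move=> hv; rewrite /right_twist -{1}sk -star_ncmul// ncmul_kappa//.
  split => [/(can_inj (starK theta)) ->|->].
    by rewrite (ncmul_cancel lk lki).
  by rewrite (ncmul_cancel lki lk)//; exact: H0_ncmul.
split.
  move=> [z /= /nablaE[hx1 zE] /nabla_adjE[hz _ e]].
  have hv := H1_mulop tau w^* hz.
  exists (star (mulop tau w^* z)) => /=.
    exists (mulop tau^* (- w) (star x)) => /=.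
      exists (star x) => /=; first by split => /=;
        [exact: H0_right_twist|rewrite ncmul_right_twist].
      by apply/dolbeaultE; split => //; exact: H1_star.
    apply/dolbeaultE; split; last by rewrite zE comm.
    by apply: (H1_norm _ (H1_star theta hz)) => p; rewrite nrm zE.
  by split => /=; [exact: H0_star|apply/yP].
move=> [u2 /= [u1 /= [u0 /= [/= hWx ->]]]].
rewrite ncmul_right_twist// => /dolbeaultE[hu0 ->] /dolbeaultE[hu1 ->].
rewrite comm => -[/= hu2 yE].
have hx1 : H1 x by rewrite -(starK theta x); exact: H1_star.
exists (mulop tau^* w x) => /=; first by apply/nablaE.
have hz : H1 (mulop tau^* w x).
  rewrite -(starK theta (mulop _ _ _)); apply: H1_star.
  exact: (H1_norm _ hu1).
apply/nabla_adjE; split => //; apply/yP => //.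
exact: H1_mulop.
Qed.

Lemma Delta1_model1 x y : H0 x -> H0 y ->
  Delta1 theta tau w kinv (x, y) <-> model1 theta tau w k (star x, star y).
Proof.
move=> hx hy.
have sx : mulop tau^* (- w) (star x) = - star (mulop tau w^* x).
  by rewrite star_mulop !conjCK opprK.
have hk2 : H0 k2 by apply: H0_l1; exact: l1_ncmul.
have k2x v : H0 v -> ncmul k2 (- star v) = - star (ncmul v k2).
  move=> hv; rewrite star_ncmul// star_ncmul// !sk.
  have h0 : H0 (0 : series2 R).
    by apply: H0_l1; exact: l1_0.
  have := ncmulDr theta (-1) hk2 (H0_star theta hv) h0.
  rewrite addr0 !scaleN1r => ->.
  rewrite [X in _ + X](_ : _ = 0) ?addr0//.
  apply/funext => p; rewrite /Defs.ncmul -[RHS](@usum0 R Z2).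
  by congr usum; apply/funext => q; rewrite !mulr0.
have H1N u : H1 (- u) <-> H1 u.
  by split=> h; apply: (H1_norm _ h) => p; rewrite normcN.
split.
  move=> [z /= /nabla_adjE[hx1 hz e] /nablaE[hz1 yE]].
  have hv := H1_mulop tau w^* hx1.
  exists (- star z) => /=.
    exists (- star (mulop tau w^* x)) => /=.
      by apply/dolbeaultE; split; [exact: H1_star|rewrite sx].
    split => /=; first by rewrite -sx; apply/H1_mulop/H1_star.
    by rewrite k2x//; congr (- star _); apply/ncmul_kappaP.
  apply/dolbeaultE; split; first exact/H1N/H1_star.
  by rewrite mulopN yE [LHS]star_mulop conjCK.
move=> [u2 /= [u1 /= /dolbeaultE[hx1 ->] [/= _ ->]] /dolbeaultE[]].
have {}hx1 : H1 x by rewrite -(starK theta x); exact: H1_star.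
have hv := H1_mulop tau w^* hx1.
rewrite sx k2x// => /H1N hu2; rewrite mulopN => yE.
have hz1 : H1 (ncmul (mulop tau w^* x) k2).
  by rewrite -(starK theta (ncmul _ _)); exact: H1_star.
have [hz _ _] := hz1.
exists (ncmul (mulop tau w^* x) k2) => /=.
  by apply/nabla_adjE; split => //; apply/esym/ncmul_kappaP.
apply/nablaE; split => //.
by apply: (can_inj (starK theta)); rewrite yE [RHS]star_mulop conjCK.
Qed.

Lemma Delta0_equiv_model0 : antiunitary_equiv ipphi (Delta0 theta tau w kinv)
  ip (model0 theta tau w k).
Proof.
exists right_twist; split.
- exact: H0_right_twist.
- move=> y hy; exists (ncmul (star y) k).
    by apply: H0_ncmul => //; exact: H0_star.
  by rewrite /right_twist (ncmul_cancel lk lki) ?starK//; exact: H0_star.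
- by move=> c x y hx hy; rewrite /right_twist ncmulDl// starDl.
- move=> x y hx hy; rewrite /right_twist ip_star; [|exact: H0_ncmul..].
  rewrite (ip_phi_mull hx hy) (ncmul_kappa hx).
  by rewrite (ip_ncmulr theta (H0_ncmul theta hx lki) hy lki) ski.
- exact: Delta0_model0.
Qed.

Lemma Delta1_equiv_model1 : antiunitary_equiv ip (Delta1 theta tau w kinv)
  ip (model1 theta tau w k).
Proof.
exists star; split.
- by move=> x; exact: H0_star.
- by move=> y hy; exists (star y); [exact: H0_star|rewrite starK].
- by move=> c x y _ _; exact: starDl.
- by move=> x y hx hy; rewrite ip_star.
- exact: Delta1_model1.
Qed.

End Operators.

(** * Equality of the heat traces *)

Section Traces.
Variable R : realType.
Local Notation C := R[i].
Local Notation Z2 := (int * int)%type.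
Implicit Types (x y z : series2 R).
Variables (theta : R) (tau w : C) (kinv : series2 R).
Hypothesis htau : 0 < complex.Im tau.
Hypotheses (lki : l1 kinv) (ski : star theta kinv = kinv).
Local Notation ncmul := (ncmul theta).
Local Notation ip := (ip theta).
Local Notation ipphi := (ip_phi theta kinv).
Local Notation kappa := (ncmul kinv kinv).
Local Notation nab := (mulop tau^* w).
Local Notation sym := (symbol tau^* w).
Local Notation nabadj := (nabla_adj theta tau w kinv).
Local Notation D0 := (Delta0 theta tau w kinv).
Local Notation D1 := (Delta1 theta tau w kinv).

Let Im_tauJ : complex.Im tau^* != 0.
Proof. by case: tau htau => a b /=; rewrite oppr_eq0 => /gt_eqF->. Qed.

Let hkap x : H0 x -> H0 (ncmul x kappa).
Proof. by move=> hx; apply: H0_ncmul => //; exact: l1_kappa. Qed.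

Lemma H0_zero : H0 (0 : series2 R).
Proof. by apply: H0_l1; exact: l1_0. Qed.

Lemma ip_phiDl d x y z : H0 x -> H0 y -> H0 z ->
  ipphi (d *: x + y) z = d * ipphi x z + ipphi y z.
Proof.
move=> hx hy hz; rewrite !ip_phi_mulr//; last by apply: H0D => //; exact: H0Z.
by rewrite ipDl//; exact: hkap.
Qed.

Lemma ip_phiZl d x z : H0 x -> H0 z -> ipphi (d *: x) z = d * ipphi x z.
Proof.
by move=> hx hz; rewrite !ip_phi_mulr ?ipZl//; [exact: hkap|exact: H0Z].
Qed.

Lemma ip_phiZr d x z : H0 x -> H0 z -> ipphi x (d *: z) = d^* * ipphi x z.
Proof.
by move=> hx hz; rewrite !ip_phi_mull ?ipZr//; [exact: hkap|exact: H0Z].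
Qed.

Lemma mulopZ sigma c d x : mulop sigma c (d *: x) = d *: mulop sigma c x.
Proof. by apply/funext => p; apply: mulrCA. Qed.

Lemma H1Z d x : H1 x -> H1 (d *: x).
Proof.
move=> [h0 h1 h2]; split; first exact: H0Z.
  by apply: (H0_le (normc_ge0 d)) h1 => p; rewrite !normcM mulrCA.
by apply: (H0_le (normc_ge0 d)) h2 => p; rewrite !normcM mulrCA.
Qed.

Lemma nabla_adjZ d z y : nabadj (z, y) -> nabadj (d *: z, d *: y).
Proof.
move=> [/= hz hy h]; split => /=; [exact: H0Z|exact: H0Z|].
move=> [x x'] /[dup] /h /= e /nablaE[hx x'E]; have [hx0 _ _] := hx.
by rewrite ip_phiZr// ipZr ?e// x'E; exact: H1_mulop.
Qed.

Lemma ncmul0l a : ncmul 0 a = 0.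
Proof.
apply/funext => p; rewrite /Defs.ncmul -[RHS](@usum0 R Z2).
by congr usum; apply/funext => q; rewrite mul0r mulr0.
Qed.

Lemma nabla_adj_ker z : H1 z -> mulop tau w^* z = 0 -> nabadj (z, 0).
Proof.
by move=> hz z0; apply/nabla_adjE => //; split => //;
  [exact: H0_zero|rewrite z0 ncmul0l].
Qed.

(** As tau is not real, m and n can be read off m + conj tau n. *)
Lemma sym_inj p q : sym p = sym q -> p = q.
Proof.
case: p q => [p1 p2] [q1 q2]; rewrite !symbolE/= => -[h1 h2].
move: h2 => /addIr /(mulfI Im_tauJ) /intr_inj e2.
by move: h1; rewrite e2 => /addIr /addIr /intr_inj ->.
Qed.

Section Eigen.
Variables (I : choiceType) (e : I -> series2 R) (lam : I -> R).
Hypothesis sr : spectral_resolution ipphi D0 e lam.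

Let He i : H0 (e i). Proof. by case: sr => -[h _ _] _; exact: h. Qed.
Let on i j : ipphi (e i) (e j) = (i == j)%:R.
Proof. by case: sr => -[_ h _] _; exact: h. Qed.
Let complete x : H0 x -> (forall i, ipphi x (e i) = 0) -> x = 0.
Proof. by case: sr => -[_ _ h] _; exact: h. Qed.

Let D0e i : D0 (e i, (lam i)%:C *: e i).
Proof.
case: sr => _ h; apply/h; split; [exact: He|by apply: H0Z; exact: He|].
move=> j; rewrite ip_phiZl// on.
by case: eqP => [->|_]; rewrite ?mulr0.
Qed.

Let H1e i : H1 (e i).
Proof. by have [z /= /nablaE[]] := D0e i. Qed.

Let adj_e i : nabadj (nab (e i), (lam i)%:C *: e i).
Proof. by have [z /= /nablaE[_ ->]] := D0e i. Qed.

Let z i := nab (e i).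
Let Hz i : H0 (z i). Proof. exact: H1_mulop. Qed.

(* Definition of the adjoint, tested against nabla (e i). *)
Let ip_nab x i : H1 x -> ip (nab x) (z i) = (lam i)%:C * ipphi x (e i).
Proof.
move=> hx; have [_ _ h] := adj_e i; have [hx0 _ _] := hx.
rewrite (h (x, nab x)); last exact/nablaE.
by rewrite /= ip_phiZr//; congr (_ * _); exact: conjc_real.
Qed.

Let ip_zz i j : ip (z i) (z j) = (lam j)%:C * (i == j)%:R.
Proof. by rewrite ip_nab// on. Qed.

Let lam_ge0 i : 0 <= lam i.
Proof.
have [r r0] := ip_ge0 theta (Hz i).
by rewrite ip_zz eqxx mulr1 => -[->].
Qed.

Let e_neq0 i : e i <> 0.
Proof.
move=> e0; have := on i i; rewrite eqxx e0.
have := ip_phiZl 0 H0_zero H0_zero; rewrite scale0r mul0r => ->.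
by move=> /esym/eqP; rewrite oner_eq0.
Qed.

Variable p0 : Z2.
Hypothesis p0P : forall p, sym p = 0 -> p = p0.
Local Notation u := (@monomial R p0).

(* A null vector e i is annihilated by nabla, so it is supported at the zero of
   the symbol. *)
Let lam_eq0 i : lam i = 0 -> sym p0 = 0 /\ exists2 d, d != 0 & e i = d *: u.
Proof.
move=> l0.
have zi0 : z i = 0.
  by apply: (ip_eq0 (theta := theta)) => //; rewrite ip_zz l0 mul0r.
have e0 p : p != p0 -> e i p = 0.
  move=> /eqP pp; have := congr1 (@^~ p) zi0; rewrite /z /mulop => /eqP.
  by rewrite mulf_eq0 => /orP[/eqP/p0P//|/eqP].
have E : e i = (e i p0) *: u.
  apply/funext => p; rewrite [RHS](_ : _ = e i p0 * monomial R p0 p)//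
    /monomial.
  by case: eqP => [->|/eqP /e0]; rewrite ?mulr1 ?mulr0.
have d0 : e i p0 != 0.
  apply/eqP => h; apply: (@e_neq0 i); rewrite E h.
  by apply/funext => p; exact: mul0r.
split; last by exists (e i p0).
have := congr1 (@^~ p0) zi0; rewrite /z /mulop => /eqP.
by rewrite mulf_eq0 (negPf d0) orbF => /eqP.
Qed.

Let lam_eq0_uniq i j : lam i = 0 -> lam j = 0 -> i = j.
Proof.
move=> /lam_eq0[_ [a a0 ea]] /lam_eq0[_ [b b0 eb]].
apply: contrapT => /eqP ij.
have hu := H0_monomial R p0; have hZ d : H0 (d *: u) by exact: H0Z.
have h1 : a * (a^* * ipphi u u) = 1.
  by have := on i i; rewrite eqxx ea ip_phiZl// ip_phiZr.
have : a * (b^* * ipphi u u) = 0.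
  by have := on i j; rewrite (negPf ij) ea eb ip_phiZl// ip_phiZr.
move=> /eqP; rewrite !mulf_eq0 (negPf a0) conjC_eq0 (negPf b0)/= => /eqP uu.
by move: h1; rewrite uu !mulr0 => /esym/eqP; rewrite oner_eq0.
Qed.

(* If the symbol vanishes at p0 then the monomial u is a null vector of Delta0;
   it cannot be orthogonal to the whole basis. *)
Let lam_eq0_ex : sym p0 = 0 -> exists i, lam i = 0.
Proof.
move=> s0; apply: contrapT => hn.
have hu := H0_monomial R p0.
have nu : nab u = 0.
  apply/funext => p; rewrite /mulop /monomial; case: eqP => [->|_].
    by rewrite s0 mul0r.
  by rewrite mulr0.
have Du : D0 (u, 0).
  exists 0 => /=; first by apply/nablaE; split; [exact: H1_monomial|rewrite nu].
  apply: nabla_adj_ker; last by apply/funext => p; exact: mulr0.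
  by rewrite -(scale0r u); apply: H1Z; exact: H1_monomial.
have u0 : u = 0.
  apply: complete => // i; have [_ _ /(_ i)] := ((sr.2 _ _).1 Du).
  rewrite -(scale0r u) ip_phiZl// mul0r => /esym/eqP.
  rewrite mulf_eq0 => /orP[/eqP[li0]|/eqP//].
  by case: hn; exists i.
have := congr1 (@^~ p0) u0; rewrite /monomial eqxx => /eqP.
by rewrite (oner_eq0 C).
Qed.

(** The basis carried over to Delta1: nabla (e i) normalized, or, for the
    possible null vector of Delta0, the generator u of the kernel of the
    adjoint.  The two kernels have the same dimension because nabla is diagonal
    in the monomials. *)
Definition transfer i : series2 R :=
  if lam i == 0 then u else ((Num.sqrt (lam i))^-1)%:C *: z i.

Let H0f i : H0 (transfer i).
Proof.
by rewrite /transfer; case: ifP => _; [exact: H0_monomial|exact: H0Z].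
Qed.

Let z_p0 i : sym p0 = 0 -> z i p0 = 0.
Proof. by move=> s0; rewrite /z /mulop s0 mul0r. Qed.

(** Completeness: if the symbol vanishes at p0 then u belongs to the family, so
    in every case a vector x orthogonal to the family has the form nabla y.  As
    <nabla y, nabla (e i)> = lam i <y, e i>_phi, y is then orthogonal to all the
    e i but the null vector, so it is a multiple of the latter and
    x = nabla y = 0. *)
Lemma transfer_onb : orthonormal_basis ip transfer.
Proof.
have hu := H0_monomial R p0.
split=> [//|i j|x hx xf].
  rewrite /transfer.
  have [li|li] := eqVneq (lam i) 0; have [lj|lj] := eqVneq (lam j) 0.
  - by rewrite (lam_eq0_uniq li lj) eqxx ip_monomial// /monomial eqxx.
  - have [s0 _] := lam_eq0 li.
    rewrite ipZr// ipC// ip_monomial// z_p0// rmorph0 mulr0.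
    by case: eqP => // ij; rewrite -ij li eqxx in lj.
  - have [s0 _] := lam_eq0 lj.
    rewrite ipZl// ip_monomial// z_p0// mulr0.
    by case: eqP => // ij; rewrite ij lj eqxx in li.
  rewrite ipZl ?ipZr ?ip_zz//; last exact: H0Z.
  have [->|_] := eqVneq i j; last by rewrite !mulr0.
  have lj0 : 0 < lam j by rewrite lt_neqAle eq_sym lj lam_ge0.
  rewrite mulr1 [X in _ * (X * _)]conjc_real -!rmorphM/=.
  rewrite -{3}(sqr_sqrtr (lam_ge0 j)) expr2 mulKf ?mulVf// gt_eqF ?sqrtr_gt0//.
have [|y hy yx] := @H0_inv _ _ w x Im_tauJ hx.
  move=> p s0; have pp := p0P s0; subst p; have [i li] := lam_eq0_ex s0.
  by have := xf i; rewrite /transfer li eqxx ip_monomial.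
have [hy0 _ _] := hy.
have ye i : lam i != 0 -> ipphi y (e i) = 0.
  move=> li; have := xf i; rewrite /transfer (negPf li) ipZr// -yx ip_nab//.
  move=> /eqP; rewrite !mulf_eq0 conjC_eq0 => /or3P[] /eqP.
  - move=> [] /eqP; rewrite invr_eq0 sqrtr_eq0 => l0.
    by move/eqP: li => -[]; apply/eqP; rewrite eq_le l0 lam_ge0.
  - by move=> [] /eqP; rewrite (negPf li).
  - by [].
have [[i0 li0]|none] := pselect (exists i0, lam i0 = 0).
  have yE : y = ipphi y (e i0) *: e i0.
    apply/eqP; rewrite -subr_eq0; apply/eqP.
    have h : H0 (y - ipphi y (e i0) *: e i0).
      by rewrite addrC -scaleNr; apply: H0D => //; apply: H0Z; exact: He.
    apply: complete => // i.
    rewrite addrC -scaleNr ip_phiDl// on.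
    have [->|ii0] := eqVneq i0 i; first by rewrite mulr1 addNr.
    rewrite mulr0 add0r; apply: ye.
    by apply: contra_neq ii0 => /(lam_eq0_uniq li0).
  have z0 : z i0 = 0.
    by apply: (ip_eq0 (theta := theta)) => //; rewrite ip_zz li0 mul0r.
  by rewrite -yx yE mulopZ -/(z i0) z0 scaler0.
have -> : x = nab y by rewrite yx.
have -> : y = 0.
  apply: complete => // i; apply: ye; apply/eqP => li; apply: none.
  by exists i.
by apply/funext => p; exact: mulr0.
Qed.

Lemma transfer_eigen i : D1 (transfer i, (lam i)%:C *: transfer i).
Proof.
rewrite /transfer; have [li|li] := eqVneq (lam i) 0.
  have [s0 _] := lam_eq0 li; rewrite li.
  exists 0 => /=.
    apply: nabla_adj_ker; first exact: H1_monomial.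
    apply/funext => p; rewrite /mulop /monomial.
    case: eqP => [->|_]; last by rewrite mulr0.
    by rewrite -[tau]conjCK -symbol_conj s0 rmorph0 mul0r.
  apply/nablaE; split.
    by rewrite -(scale0r u); apply: H1Z; exact: H1_monomial.
  by rewrite scale0r; apply/funext => p; rewrite /mulop mulr0.
set c := (_^-1)%:C.
exists (c *: ((lam i)%:C *: e i)) => /=; first exact: (nabla_adjZ c (adj_e i)).
apply/nablaE; split; first by do 2!apply: H1Z.
by rewrite !mulopZ !scalerA mulrC.
Qed.

End Eigen.

(** When the symbol has no zero, any index serves as p0. *)
Lemma sym_kernel : exists p0, forall p, sym p = 0 -> p = p0.
Proof.
have [[p0 s0]|none] := pselect (exists p0, sym p0 = 0).
  by exists p0 => p s; apply: sym_inj; rewrite s.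
by exists 0 => p s; case: none; exists p.
Qed.

(** Evaluated on an eigenbasis of Delta0 and on its transfer, the two traces are
    sums of the same family. *)
Lemma heat_traces_agree (t : R) (E0 E1 : series2 R -> series2 R) (v0 v1 : C) :
  is_heat_operator ipphi D0 t E0 -> is_trace ipphi E0 v0 ->
  is_heat_operator ip D1 t E1 -> is_trace ip E1 v1 -> v0 = v1.
Proof.
move=> [I [e [lam [sr heat0]]]] tr0 [I1 [e1 [lam1 [sr1 heat1]]]] tr1.
have [p0 p0P] := sym_kernel.
pose f := transfer e lam p0.
have fb : orthonormal_basis ip f by exact: transfer_onb.
have [He on _] := sr.1; have [Hf onf _] := fb.
have := tr0 _ _ sr.1; have := tr1 _ _ fb.
have -> : (fun i => ipphi (E0 (e i)) (e i)) =
    (fun i => (expR (- t * lam i))%:C).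
  apply/funext => i; have [_ ->] := heat0 _ (He i).
  by rewrite on eqxx mulr1.
have -> : (fun i => ip (E1 (f i)) (f i)) = (fun i => (expR (- t * lam i))%:C).
  apply/funext => i; have [hE hEe] := heat1 _ (Hf i).
  set d := (expR _)%:C.
  suff -> : E1 (f i) = d *: f i by rewrite ipZl// onf eqxx mulr1.
  apply/eqP; rewrite -subr_eq0; apply/eqP.
  have [[He1 _ complete1] sr1E] := sr1.
  apply: complete1; first by rewrite -scaleNr; apply: H0D => //; exact: H0Z.
  move=> j; rewrite addrC -scaleNr ipDl// hEe mulNr.
  have [_ _ /(_ j)] := (sr1E _ _).1 (transfer_eigen sr p0P i).
  rewrite ipZl// => h.
  have [->|ne] := eqVneq (ip (f i) (e1 j)) 0;
    first by rewrite !mulr0 oppr0 addr0.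
  move: h => /(mulIf ne) -[h].
  by rewrite /d h addNr.
by move=> s1 s0; exact: sums_to_uniq s0 s1.
Qed.

Lemma small_zero (a : C) (K d : R) : 0 < d ->
  (forall t, 0 < t < d -> normc a <= K * t) -> a = 0.
Proof.
move=> d0 h; apply: eq0_normc; apply/eqP; rewrite eq_le normc_ge0 andbT leNgt.
apply/negP => a0.
pose K' := 2 * (`|K| + 1).
have K0 : 0 < K' by rewrite mulr_gt0// ltr_wpDl.
pose t := Num.min (d / 2) (normc a / K').
have t0 : 0 < t by rewrite lt_min !divr_gt0.
have td : t < d by rewrite /t gt_min ltr_pdivrMr// mulr_natr mulr2n ltrDl d0.
have := h t; rewrite t0 td => /(_ isT).
have tK : t * K' <= normc a by rewrite -ler_pdivlMr// ge_min lexx orbT.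
have := ler_norm K; rewrite /K' in tK; nra.
Qed.

(** The traces being equal, the difference of the two expansions reads
    |a + b t| <= M t^2 with a and b the differences of the first two
    coefficients; letting t tend to 0 twice gives a = 0, then b = 0. *)
Lemma heat_coeff2 (B0 B1 : nat -> C) :
  heat_expansion ipphi D0 B0 -> heat_expansion ip D1 B1 ->
  B0 2%N - B1 2%N = 0.
Proof.
move=> [Tr0 [ex0 as0]] [Tr1 [ex1 as1]].
have Tr t : 0 < t -> Tr0 t = Tr1 t.
  move=> t0; have [E0 h0 tr0] := ex0 t t0; have [E1 h1 tr1] := ex1 t t0.
  exact: heat_traces_agree h0 tr0 h1 tr1.
have [M0 M00 near0] := as0 2%N; have [M1 M10 near1] := as1 2%N.
set a := B0 0%N - B1 0%N; set b := B0 2%N - B1 2%N.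
pose M := complex.Re (M0 + M1).
have ME : M0 + M1 = M%:C by rewrite RRe_real// ger0_real// addr_ge0.
have [d d0 H] : exists2 d, 0 < d & forall t, 0 < t < d ->
    normc (a + b * t%:C) <= M * t ^+ 2.
  have [d /= d0 near01] := (@nbhs_ballP R R (0 : R) _).1 (filterI near0 near1).
  exists d => // t /andP[t0 td].
  have : ball (0 : R) d t by rewrite /ball/= sub0r normrN gtr0_norm.
  move=> /near01 /(_ t0) [].
  rewrite (Tr t t0) !big_ord_recr !big_ord0/= !add0r !expr0 !mulr1 !expr1.
  set T := Tr1 t; have tn : t%:C != 0 by rewrite fmorph_eq0 gt_eqF.
  move=> h0 h1; rewrite -lecR -normE rmorphM/= -ME.
  have -> : a + b * t%:C = t%:C * (
    (T - t%:C^-1 * (B1 0%N + B1 2%N * t%:C)) -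
    (T - t%:C^-1 * (B0 0%N + B0 2%N * t%:C))).
    by rewrite /a /b; field.
  have tp : 0 <= t%:C by rewrite ler0c ltW.
  rewrite normrM (ger0_norm tp).
  apply: le_trans (ler_wpM2l tp (le_trans (ler_normB _ _) (lerD h1 h0))) _.
  rewrite le_eqVlt; apply/orP; left; apply/eqP.
  by rewrite rmorphXn/=; field.
have a0 : a = 0.
  apply: (@small_zero _ (M * d + normc b) d) => // t td.
  have := H t td; have /andP[t0 td'] := td.
  have := le_normcD (a + b * t%:C) (- (b * t%:C)).
  rewrite addrK normcN normcM normc_real gtr0_norm// => h1 h2.
  have M0' : 0 <= M by rewrite -ler0c -ME addr_ge0.
  have : M * t ^+ 2 <= M * d * t.
    rewrite expr2 mulrA.
    exact: ler_wpM2r (ltW t0) _ _ (ler_wpM2l M0' (ltW td')).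
  by rewrite mulrDl; lra.
apply: (@small_zero _ M d) => // t td; have := H t td; have /andP[t0 _] := td.
by rewrite a0 add0r normcM normc_real gtr0_norm// expr2 mulrA ler_pM2r.
Qed.

End Traces.

Theorem theorem4p1 (R : realType) (theta : R) (tau w : R[i])
    (k kinv : series2 R)
    (htheta : irrational theta) (htau : 0 < complex.Im tau)
    (hk : smooth k) (hpos : positive theta k) (hinv : is_inverse theta k kinv) :
  [/\ antiunitary_equiv (ip_phi theta kinv) (Delta0 theta tau w kinv)
        (ip theta) (model0 theta tau w k),
      antiunitary_equiv (ip theta) (Delta1 theta tau w kinv)
        (ip theta) (model1 theta tau w k) &
      forall B0 B1 : nat -> R[i],
        heat_expansion (ip_phi theta kinv) (Delta0 theta tau w kinv) B0 ->
        heat_expansion (ip theta) (Delta1 theta tau w kinv) B1 ->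
        B0 2%N - B1 2%N = 0].
Proof.
have [ski_ kki kik] := hinv.
have lk := smooth_l1 hk; have lki := smooth_l1 ski_.
have sk := positive_star lk hpos.
have ski := inverse_star lk lki sk kki.
split.
- exact: Delta0_equiv_model0.
- exact: Delta1_equiv_model1.
- move=> B0 B1; exact: heat_coeff2.
Qed.
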